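(* Consider the integral equation $$g(x)=a+\kappa\,(s(x)-s(c))+\int_\ell^r v_c(x,y)g(y)\,\mu_A(dy),\qquad( * )$$ where $\mu_A$ is the Revuz measure associated with a PCAF $A$ with $\mu_A((\ell,r))>0$, and $v_c(x,y)$ is either $s(x\vee y)-s(c\vee y)$ for all $(x,y)\in(\ell,r)^2$ or $s(c\wedge y)-s(x\wedge y)$ for all $(x,y)\in(\ell,r)^2$. (1) Suppose that $c\in(\ell,r)$, $a\ge0$ and $\kappa\in\mathbb R$. Then there exists at most one non-negative solution $g$ to $( * )$ such that $g$ is uniformly integrable near $\ell$ (resp. $r$) if $v_c(x,y)=s(x\vee y)-s(c\vee y)$ (resp. $v_c(x,y)=s(c\wedge y)-s(x\wedge y)$). (2) Suppose that $c=\ell$ (resp. $c=r$) if $v_c(x,y)=s(x\vee y)-s(c\vee y)$ (resp. $v_c(x,y)=s(c\wedge y)-s(x\wedge y)$). Assume further that $\ell$ (resp. $r$) is not an $A$-natural boundary. Then for any $a\ge0$ and $\kappa\ge0$ (resp. $\kappa\le0$) there exists at most one non-negative solution $g$ to $( * )$ such that $g$ is uniformly integrable near $\ell$ (resp. $r$) if $v_c(x,y)=s(x\vee y)-s(c\vee y)$ (resp. $v_c(x,y)=s(c\wedge y)-s(x\wedge y)$).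
   Context: Let $-\infty\le\ell<r\le\infty$ and let $X=(\Omega,\mathcal F,\mathcal F_t,X_t,\theta_t,P^x)$ be a regular one-dimensional diffusion on $(\ell,r)$ with no killing inside $(\ell,r)$ and absorbing boundaries, lifetime $\zeta$, strictly increasing continuous scale function $s$ (extended to $\ell,r$ by limits) and speed measure $m$, with generator $\frac{d}{dm}\frac{d}{ds}$. $T_b$ is the hitting time of $b$ and $X^{T_b}$ is $X$ stopped at $T_b$. A PCAF $A$ is an adapted $[0,\infty]$-valued family, a.s. nondecreasing and finite continuous on $[0,\zeta)$, with $A_t=A_{\zeta-}$ for $t\ge\zeta$ and $A_{t+s}=A_t+A_s\circ\theta_t$ a.s.; its Revuz measure is defined by $\int f\,d\mu_A=\lim_{t\to0}t^{-1}\int_\ell^rE^x[\int_0^tf(X_u)dA_u]m(dx)$, and is Radon on $(\ell,r)$. For $b\in(\ell,r)$, $\ell$ is $A$-natural if both $\int_\ell^b\mu_A((z,b))s(dz)$ and $\int_\ell^b(s(b)-s(z))\mu_A(dz)$ are infinite; $r$ is $A$-natural if both $\int_b^r\mu_A((b,z))s(dz)$ and $\int_b^r(s(z)-s(b))\mu_A(dz)$ are infinite. A function $g$ is uniformly integrable near $\ell$ (resp. $r$) if the family $\{g(X^{T_b}_\tau):\tau\text{ a stopping time}\}$ is $P^x$-uniformly integrable for any $x<b$ (resp. $x>b$). A solution of $( * )$ is implicitly assumed to satisfy $\int_\ell^r|v_c(x,y)g(y)|\mu_A(dy)<\infty$ for all $x\in(\ell,r)$. Convention: $0\times\infty=0$.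 *)

(* Defs.v *)
From HB Require Import structures.
From mathcomp Require Import all_boot all_order all_algebra.
From mathcomp Require Import all_classical all_reals all_analysis.
From mathcomp Require Import measurable_realfun.
Import Order.TTheory GRing.Theory Num.Theory.
Import numFieldNormedType.Exports.

Set Implicit Arguments.
Unset Strict Implicit.
Unset Printing Implicit Defensive.

Local Open Scope classical_set_scope.
Local Open Scope ring_scope.
Local Open Scope ereal_scope.

(* The open interval (l, r) of R, with end points in [-oo, +oo]. *)
Definition ooitv (R : realType) (l r : \bar R) : set R :=
  [set x | l < x%:E /\ x%:E < r].

(* Extension of a function on (l, r) to the closed interval [l, r] by its
   limits at the end points. *)
Definition ext_lim (R : realType) (l r : \bar R) (h : R -> \bar R)
    (y : \bar R) : \bar R :=
  if (l < y < r) then h (fine y)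
  else lim (h (fine z) @[z --> within [set z : \bar R | l < z < r] (nbhs y)]).

Definition radon_on (R : realType) (l r : \bar R)
    (mu : {measure set R -> \bar R}) : Prop :=
  forall a b : R, l < a%:E -> b%:E < r -> mu `[a, b]%classic < +oo.

Definition is_stieltjes (R : realType) (l r : \bar R) (f : R -> \bar R)
    (nu : {measure set R -> \bar R}) : Prop :=
  (forall u v : R, l < u%:E -> (u <= v)%R -> v%:E < r ->
     nu `]u, v]%classic = f v - f u) /\
  nu (~` ooitv l r) = 0.

(* The Lebesgue-Stieltjes measure df on (l, r): it is unique when f is finite
   on (l, r), and exists when f is moreover nondecreasing and right-continuous
   there. The library's lebesgue_stieltjes_measure only covers functions that
   are finite, nondecreasing and right-continuous on all of R, which excludes
   scale functions and additive functionals that explode at an end point. *)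
Definition stieltjes (R : realType) (l r : \bar R) (f : R -> \bar R) :
    {measure set R -> \bar R} :=
  match pselect (exists nu, is_stieltjes l r f nu) with
  | left e => projT1 (cid e)
  | right _ => mzero
  end.

Definition uniformly_integrable (R : realType) (d : measure_display)
    (Om : measurableType d) (P : probability Om R) (Y : set (Om -> \bar R)) :
    Prop :=
  forall e : R, (0 < e)%R -> exists K : R, forall Z, Y Z ->
    \int[P]_(w in [set w | K%:E < `|Z w|]) `|Z w| <= e%:E.

Section process.
Context (R : realType) (l r : \bar R) (d : measure_display)
  (Om : measurableType d).
(* Times are nonnegative reals; the values at negative times are irrelevant.
   The state space is [l, r], seen inside \bar R. *)
Variables (F : R -> set (set Om)) (X : R -> Om -> \bar R)
  (theta : R -> Om -> Om) (P : \bar R -> probability Om R).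

Definition stopping_time (T : Om -> \bar R) : Prop :=
  (forall w, 0 <= T w) /\
  (forall t : R, (0 <= t)%R -> F t [set w | T w <= t%:E]).

(* The sigma-algebra F_T. *)
Definition stopped_salgebra (T : Om -> \bar R) : set (set Om) :=
  [set L | measurable L /\
    forall t : R, (0 <= t)%R -> F t (L `&` [set w | T w <= t%:E])].

Definition first_time (B : set (\bar R)) (w : Om) : \bar R :=
  ereal_inf [set t%:E | t in [set t : R | (0 <= t)%R /\ B (X t w)]].

Definition hitting_time (b : R) : Om -> \bar R := first_time [set b%:E].

Definition lifetime : Om -> \bar R :=
  first_time [set y | ~ (l < y < r)].

(* X at a time in [0, +oo], with X_oo the limit of X_t as t tends to +oo. *)
Definition state_at (t : \bar R) (w : Om) : \bar R :=
  match t with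
  | u%:E => X u w
  | _ => lim (X u w @[u --> +oo%R])
  end.

(* X^T_t. *)
Definition stopped (T : Om -> \bar R) (t : \bar R) (w : Om) : \bar R :=
  state_at (Order.min t (T w)) w.

(* The sigma-algebra generated by all the X_t. *)
Definition path_salgebra : set (set Om) :=
  <<s [set C | exists t : R, exists B : set (\bar R),
         [/\ (0 <= t)%R, measurable B & C = X t @^-1` B]] >>.

(* Paths live in [l, r] without cemetery state, so that there is no killing
   inside (l, r). *)
Record regular_diffusion : Prop := RegularDiffusion {
  diff_filtration : forall t : R, (0 <= t)%R ->
    sigma_algebra setT (F t) /\ F t `<=` measurable;
  diff_filtration_le : forall t u : R, (0 <= t)%R -> (t <= u)%R ->
    F t `<=` F u;
  diff_adapted : forall (t : R) (B : set (\bar R)), (0 <= t)%R ->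
    measurable B -> F t (X t @^-1` B);
  diff_range : forall (t : R) w, (0 <= t)%R -> l <= X t w <= r;
  diff_continuous : forall w,
    {within `[0%R, +oo[%classic, continuous (fun t : R => X t w)};
  diff_absorbing : forall (t u : R) w, (0 <= t)%R -> (t <= u)%R ->
    X t w = l \/ X t w = r -> X u w = X t w;
  diff_shift : forall (t u : R) w, (0 <= t)%R -> (0 <= u)%R ->
    X u (theta t w) = X (t + u)%R w;
  diff_start : forall x, l <= x <= r -> P x [set w | X 0%R w = x] = 1;
  diff_kernel : forall B, path_salgebra B ->
    measurable_fun [set x | l <= x <= r] (fun x => P x B);
  diff_strong_markov : forall x T L B, l <= x <= r -> stopping_time T ->
    stopped_salgebra T L -> path_salgebra B ->
    P x [set w | [/\ L w, T w < +oo & B (theta (fine (T w)) w)]] =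
    \int[P x]_(w in [set w | L w /\ T w < +oo]) P (X (fine (T w)) w) B;
  diff_regular : forall x y : R, ooitv l r x -> ooitv l r y ->
    0 < P x%:E [set w | hitting_time y w < +oo]
}.

Record scale_function (s : R -> R) : Prop := ScaleFunction {
  scale_increasing : forall x y, ooitv l r x -> ooitv l r y ->
    (x < y)%R -> (s x < s y)%R;
  scale_continuous : {within ooitv l r, continuous s};
  scale_hitting : forall a x b : R, l < a%:E -> (a < x)%R -> (x < b)%R ->
    b%:E < r ->
    P x%:E [set w | hitting_time a w < hitting_time b w] =
    ((s b - s x) / (s b - s a))%R%:E
}.

Definition green (s : R -> R) (a b x y : R) : R :=
  ((s (Num.min x y) - s a) * (s b - s (Num.max x y)) / (s b - s a))%R.

(* The Green operator of X killed on leaving (a, b) is the integral operator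
   with kernel green s a b against m, i.e. it inverts - d/dm d/ds with Dirichlet
   conditions at a and b. This is the normalization of m for which the
   generator of X is d/dm d/ds (m is twice the Lebesgue measure for a Brownian
   motion in its natural scale s(x) = x). *)
Record speed_measure (s : R -> R) (m : {measure set R -> \bar R}) : Prop :=
  SpeedMeasure {
  speed_radon : radon_on l r m;
  speed_green : forall (a x b : R) (f : R -> \bar R),
    l < a%:E -> (a < x)%R -> (x < b)%R -> b%:E < r ->
    measurable_fun setT f -> (forall y, 0 <= f y) ->
    \int[P x%:E]_w \int[lebesgue_measure]_(u in
      [set u : R | (0 <= u)%R /\
         u%:E < Order.min (hitting_time a w) (hitting_time b w)])
      f (fine (X u w)) =
    \int[m]_(y in `]a, b[%classic) ((green s a b x y)%:E * f y)
}.

(* Almost surely means P^x-almost surely for all x in (l, r). *)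
Record pcaf (A : R -> Om -> \bar R) : Prop := Pcaf {
  pcaf_adapted : forall (t : R) (B : set (\bar R)), (0 <= t)%R ->
    measurable B -> F t (A t @^-1` B);
  pcaf_ge0 : forall (t : R) w, (0 <= t)%R -> 0 <= A t w;
  pcaf_path : forall x, ooitv l r x -> {ae P x%:E, forall w,
    [/\ forall t u : R, (0 <= t)%R -> (t <= u)%R -> u%:E < lifetime w ->
          A t w <= A u w,
        forall t : R, (0 <= t)%R -> t%:E < lifetime w -> A t w \is a fin_num,
        {within [set t : R | (0 <= t)%R /\ t%:E < lifetime w],
          continuous (fun t : R => A t w)} &
        forall z t : R, lifetime w = z%:E -> (z <= t)%R ->
          A u w @[u --> z^'-] --> A t w]};
  pcaf_additive : forall (t u : R) x, (0 <= t)%R -> (0 <= u)%R ->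
    ooitv l r x ->
    {ae P x%:E, forall w, A (t + u)%R w = A t w + A u (theta t w)}
}.

(* The integral of f(X_u) dA_u over (0, t]; dA is carried by (0, lifetime). *)
Definition pcaf_integral (A : R -> Om -> \bar R) (f : R -> \bar R) (t : R)
    (w : Om) : \bar R :=
  \int[stieltjes 0 (lifetime w) (fun u => A u w)]_(u in `]0%R, t]%classic)
    f (fine (X u w)).

Record revuz_measure (m : {measure set R -> \bar R}) (A : R -> Om -> \bar R)
    (mu : {measure set R -> \bar R}) : Prop := RevuzMeasure {
  revuz_radon : radon_on l r mu;
  revuz_lim : forall f : R -> \bar R,
    measurable_fun setT f -> (forall y, 0 <= f y) ->
    (t^-1)%:E * \int[m]_(x in ooitv l r)
      \int[P x%:E]_w pcaf_integral A f t w @[t --> 0%R^'+]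
    --> \int[mu]_(x in ooitv l r) f x
}.

Definition stopped_family (g : R -> R) (b : R) : set (Om -> \bar R) :=
  [set Z | exists2 tau, stopping_time tau &
    Z = fun w => ext_lim l r (EFin \o g)
                   (stopped (hitting_time b) (tau w) w)].

Definition ui_near_left (g : R -> R) : Prop :=
  forall x b : R, l < x%:E -> (x < b)%R -> b%:E < r ->
    uniformly_integrable (P x%:E) (stopped_family g b).

Definition ui_near_right (g : R -> R) : Prop :=
  forall x b : R, l < b%:E -> (b < x)%R -> x%:E < r ->
    uniformly_integrable (P x%:E) (stopped_family g b).

End process.

Section equation.
Context (R : realType) (l r : \bar R).
Variables (s : R -> R) (mu : {measure set R -> \bar R}).

(* Whether these integrals are finite does not depend on b. *)
Definition natural_left : Prop :=
  forall b : R, ooitv l r b ->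
    \int[stieltjes l r (EFin \o s)]_(z in ooitv l b%:E)
      mu `]z, b[%classic = +oo /\
    \int[mu]_(z in ooitv l b%:E) (s b - s z)%R%:E = +oo.

Definition natural_right : Prop :=
  forall b : R, ooitv l r b ->
    \int[stieltjes l r (EFin \o s)]_(z in ooitv b%:E r)
      mu `]b, z[%classic = +oo /\
    \int[mu]_(z in ooitv b%:E r) (s z - s b)%R%:E = +oo.

Definition scale_ext : \bar R -> \bar R := ext_lim l r (EFin \o s).

Definition v_left (c : \bar R) (x y : R) : \bar R :=
  scale_ext (Order.max x%:E y%:E) - scale_ext (Order.max c y%:E).

Definition v_right (c : \bar R) (x y : R) : \bar R :=
  scale_ext (Order.min c y%:E) - scale_ext (Order.min x%:E y%:E).

(* The values of g outside (l, r) are irrelevant. The product in \bar R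
   satisfies 0 * +oo = 0. *)
Record nonneg_solution (v : R -> R -> \bar R) (c : \bar R) (a kappa : R)
    (g : R -> R) : Prop := NonnegSolution {
  sol_ge0 : forall x, ooitv l r x -> (0 <= g x)%R;
  sol_integrable : forall x, ooitv l r x ->
    mu.-integrable (ooitv l r) (fun y => v x y * (g y)%:E);
  sol_eq : forall x, ooitv l r x ->
    (g x)%:E = a%:E + kappa%:E * (scale_ext x%:E - scale_ext c)
      + \int[mu]_(y in ooitv l r) (v x y * (g y)%:E)
}.

Definition at_most_one (Q : (R -> R) -> Prop) : Prop :=
  forall g1 g2, Q g1 -> Q g2 -> forall x, ooitv l r x -> g1 x = g2 x.

End equation.

(* Main.v *)
Require Import Defs.
From HB Require Import structures.
From mathcomp Require Import all_boot all_order all_algebra.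
From mathcomp Require Import all_classical all_reals all_analysis.
From mathcomp Require Import measurable_realfun.
From mathcomp Require Import ring lra.
Import Order.TTheory GRing.Theory Num.Theory.
Import numFieldNormedType.Exports.

(** Write [h] for the difference of two solutions. The inhomogeneous terms
    cancel, and [h] solves the homogeneous integral equation. Reflecting the
    line exchanges the two choices of [v_c], so only
    [v_c(x, y) = s (max x y) - s (max c y)] has to be treated. For this kernel
    the equation says that [h] has an [s]-derivative equal at [x] to the flux,
    the integral of [h] over [(l, x)] against [mu]; this flux vanishes at [l],
    and [kappa] has disappeared ([zero_flux_of_kernel]).

    When [c] is interior, [h c = 0], and a maximum principle gives [h = 0] to
    the left of [c]. Indeed [h] is [s]-convex where it is positive. If [h] is
    positive somewhere left of [c], the flux there is nonnegative: either [h] is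
    positive down to [l], or it increases from a zero. By convexity [h] can then
    never return to 0, contradicting [h c = 0] ([zfs_le0_left]; the same applies
    to [- h]). To the right of [c], where [mu] is finite on compact intervals,
    Gronwall's inequality propagates [h = 0] step by step ([zfs_eq0_right]).

    When [c = l], the equation reads
    [h x = \int_(l, x) (s x - s y) h y mu(dy)], and it suffices that [h]
    vanishes near [l]; Gronwall then works to the right as before. If
    [\int_(l, b) (s b - s y) mu(dy)] is finite, it is small for [b] close to
    [l], and Gronwall applies to [\int_(l, x) (s x - s y) |h y| mu(dy)]
    ([left_end_eq0_of_scale]). Otherwise, as [l] is not natural,
    [\int_(l, b) mu (z, b) s(dz)] is finite. By Tonelli it equals
    [\int_(l, b) (s y - s l) mu(dy)], and Gronwall applies to
    [\int_(l, x) |h| dmu] because [|h y| <= (s y - s l) \int_(l, y) |h| dmu]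
    ([left_end_eq0_of_mass]). For this the Stieltjes measure [ds] on [(l, r)]
    has to be constructed, since [s] may explode at the end points
    ([ex_scale_measure]). *)

Local Open Scope classical_set_scope.
Local Open Scope ring_scope.
Local Open Scope ereal_scope.

Set Implicit Arguments.
Unset Strict Implicit.
Unset Printing Implicit Defensive.

(** * Open intervals with extended end points *)

Section open_interval.
Context {R : realType}.
Implicit Types (l r : \bar R) (x y : R).

Lemma open_ooitv l r : open (ooitv l r).
Proof. exact: openI (@open_ereal_gt R l) (@open_ereal_lt R r). Qed.

Lemma measurable_ooitv l r : measurable (ooitv l r).
Proof. by apply: open_measurable; exact: open_ooitv. Qed.

Lemma sub_ooitv l r x : x%:E < r -> ooitv l x%:E `<=` ooitv l r.
Proof. by move=> xr y [ly yx]; split => //; exact: lt_trans yx xr. Qed.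

Lemma sub_ooitv_real l x y : (x <= y)%R -> ooitv l x%:E `<=` ooitv l y%:E.
Proof. by move=> xy z [lz zx]; split => //; exact: lt_le_trans zx _. Qed.

Lemma ooitv_between l r x y z :
  ooitv l r x -> ooitv l r z -> (x <= y)%R -> (y <= z)%R -> ooitv l r y.
Proof.
move=> [lx _] [_ zr] xy yz.
by split; [exact: lt_le_trans lx _|exact: le_lt_trans zr].
Qed.

Lemma ooitv_max l r x y :
  ooitv l r x -> ooitv l r y -> ooitv l r (Num.max x y).
Proof. by rewrite /Num.max; case: ifP. Qed.

Lemma ooitv_right l r x : ooitv l r x -> exists2 y, ooitv l r y & (x < y)%R.
Proof.
move=> [lx]; case: r => [r| |//].
- rewrite lte_fin => xr; exists ((x + r) / 2)%R; last by lra.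
  split; last by rewrite lte_fin; lra.
  by apply: lt_trans lx _; rewrite lte_fin; lra.
- move=> _; exists (x + 1)%R; last by lra.
  by split; [apply: lt_trans lx _; rewrite lte_fin; lra|exact: ltry].
Qed.

(** A sequence decreasing to the possibly infinite left end point: it turns
    limits at that end point into countable ones. *)
Lemma ooitv_left_seq l b : l < b%:E -> exists a : R^nat,
  [/\ forall n, ooitv l b%:E (a n),
      forall n m, (n <= m)%N -> (a m <= a n)%R &
      forall y, l < y%:E -> exists n, (a n < y)%R].
Proof.
case: l => [l| |]; last 2 first.
- by rewrite ltNge leey.
- move=> _; exists (fun n => b - 1 - n%:R)%R; split.
  + move=> n; split; first exact: ltNyr.
    by rewrite lte_fin; have := ler0n R n; lra.
  + by move=> n m; rewrite -(ler_nat R); lra.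
  + move=> y _.
    have [n _ /(_ _ (leqnn _)) /= hn] := @nbhs_infty_gtr R (b - 1 - y)%R.
    by exists n; lra.
rewrite lte_fin => lb.
exists (fun n => l + (b - l) * n.+2%:R^-1)%R; split.
- move=> n; split; rewrite lte_fin.
    by rewrite ltrDl mulr_gt0 ?subr_gt0 ?invr_gt0.
  by rewrite -ltrBrDl gtr_pMr ?subr_gt0// invf_lt1 ?ltr1n.
- move=> n m nm; rewrite lerD2l ler_pM2l ?subr_gt0// lef_pV2 ?posrE//.
  by rewrite ler_nat !ltnS.
- move=> y; rewrite lte_fin => ly.
  have [n _ /(_ _ (leqnn _)) /= hn] := @nbhs_infty_gtr R ((b - l) / (y - l))%R.
  exists n; rewrite -ltrBrDl ltr_pdivrMr// mulrC -ltr_pdivrMr ?subr_gt0//.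
  by apply: lt_trans hn _; rewrite ltr_nat ltnW.
Qed.

Lemma ooitv_bigcup l b (a : R^nat) : (forall n, ooitv l b%:E (a n)) ->
  (forall y, l < y%:E -> exists n, (a n < y)%R) ->
  ooitv l b%:E = \bigcup_n `[a n, b[%classic.
Proof.
move=> aI acvg; apply/seteqP; split => y /=.
  move=> [ly yb]; have [n any] := acvg _ ly.
  by exists n => //=; rewrite in_itv/= (ltW any)/= -lte_fin.
move=> [n _] /=; rewrite in_itv/= => /andP[any yb]; split => //.
by apply: lt_le_trans (aI n).1 _; rewrite lee_fin.
Qed.

Lemma ooitv_split l a b : l < a%:E -> (a <= b)%R ->
  ooitv l b%:E = ooitv l a%:E `|` `[a, b[%classic.
Proof.
move=> la ab; apply/seteqP; split => y /=.
  move=> [ly yb]; case: (ltP y a) => ya.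
    by left; split => //; rewrite lte_fin.
  by right; rewrite in_itv/= ya -lte_fin.
case=> [|]; first exact: sub_ooitv_real.
rewrite in_itv/= => /andP[ay yb]; split => //.
by apply: lt_le_trans la _; rewrite lee_fin.
Qed.

Lemma ooitv_split_disj l a b : [disjoint ooitv l a%:E & `[a, b[%classic].
Proof.
apply/disj_setPS => y [[_]] /=; rewrite lte_fin in_itv/= => ya /andP[ay _].
by move: (lt_le_trans ya ay); rewrite ltxx.
Qed.

End open_interval.

(** * Two integral inequalities *)

Section integral_inequalities.
Context {R : realType}.
Implicit Types (mu : {measure set R -> \bar R}).

(** A finite integral leaves little mass near the left end point. *)
Lemma small_integral_left mu (l : \bar R) (b : R) (f : R -> \bar R) :
  l < b%:E -> measurable_fun (ooitv l b%:E) f ->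
  (forall y, ooitv l b%:E y -> 0 <= f y) ->
  \int[mu]_(y in ooitv l b%:E) f y < +oo ->
  exists2 x, ooitv l b%:E x & \int[mu]_(y in ooitv l x%:E) f y < 1.
Proof.
move=> lb mf f0 foo; have [a [aI amono acvg]] := ooitv_left_seq lb.
have mI := measurable_ooitv l b%:E.
have sub n : `[a n, b[%classic `<=` ooitv l b%:E.
  by rewrite (ooitv_bigcup aI acvg) => y ?; exists n.
have : \int[mu]_(y in `[a n, b[) f y @[n --> \oo] -->
       \int[mu]_(y in ooitv l b%:E) f y.
  rewrite [in X in _ --> X](ooitv_bigcup aI acvg).
  apply: ge0_nondecreasing_set_cvg_integral => //.
  - move=> n m nm; apply/subsetPset => y /=.
    rewrite !in_itv/= => /andP[any ->]; rewrite andbT.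
    exact: le_trans (amono _ _ nm) any.
  - by move=> n; exact: measurable_funS mf.
  - by move=> n y /sub; exact: f0.
set J := (X in _ --> X) in foo *.
have J0 : 0 <= J by exact: integral_ge0.
have Jfin : J \is a fin_num by rewrite ge0_fin_numE.
move=> cvJ; have nJ : nbhs J [set y | J - 1 < y].
  apply: open_nbhs_nbhs; split; first exact: open_ereal_gt_ereal.
  by rewrite /= -(fineK Jfin) -EFinB lte_fin; lra.
have [n _ /(_ _ (leqnn _)) /= hn] := cvJ _ nJ; exists (a n) => //.
have anb : (a n <= b)%R by apply: ltW; rewrite -lte_fin; exact: (aI n).2.
have mA := measurable_ooitv l (a n)%:E.
have JE : J = \int[mu]_(y in ooitv l (a n)%:E) f y +
              \int[mu]_(y in `[a n, b[) f y.
  rewrite /J (ooitv_split (aI n).1 anb) ge0_integral_setU//.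
  - by rewrite -(ooitv_split (aI n).1 anb).
  - by rewrite -(ooitv_split (aI n).1 anb).
  - exact: ooitv_split_disj.
move: hn Jfin; rewrite JE fin_numD => hn /andP[uf vf].
move: hn uf vf; case: (\int[mu]_(y in ooitv l (a n)%:E) f y) => [u| |]//.
case: (\int[mu]_(y in `[a n, b[) f y) => [v| |]// + _ _.
by rewrite (_ : u%:E + v%:E - 1 = (u + v - 1)%:E)// !lte_fin; lra.
Qed.

(** Gronwall's principle in weighted form: integrating the pointwise bound
    against [w] gives [M <= M * theta] with [theta < 1] for the weighted
    integral [M] of [f], whence [M = 0]. *)
Lemma weighted_gronwall mu (D : set R) (w psi f : R -> \bar R) :
  measurable D -> measurable_fun D w -> measurable_fun D psi ->
  measurable_fun D f ->
  (forall y, D y -> 0 <= w y) -> (forall y, D y -> 0 <= psi y) ->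
  (forall y, D y -> 0 <= f y) ->
  \int[mu]_(y in D) (w y * f y) < +oo ->
  (forall y, D y -> f y <= psi y * \int[mu]_(z in D) (w z * f z)) ->
  \int[mu]_(y in D) (w y * psi y) < 1 ->
  forall y, D y -> f y = 0.
Proof.
move=> mD mw mpsi mf w0 psi0 f0; set M := \int[mu]_(z in D) _ => Moo fM theta1.
have M0 : 0 <= M by apply: integral_ge0 => y Dy; rewrite mule_ge0 ?w0 ?f0.
have Mfin : M \is a fin_num by rewrite ge0_fin_numE.
have wpsi0 y : D y -> 0 <= w y * psi y by move=> Dy; rewrite mule_ge0 ?w0 ?psi0.
have Mle : M <= (\int[mu]_(y in D) (w y * psi y)) * M.
  rewrite -ge0_integralZr//; last by apply: emeasurable_funM.
  apply: ge0_le_integral => //.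
  - by move=> y Dy; rewrite mule_ge0 ?w0 ?f0.
  - exact: emeasurable_funM.
  - apply: emeasurable_funM; [exact: emeasurable_funM|exact: measurable_cst].
  - by move=> y Dy; rewrite -muleA; apply: lee_wpmul2l; [exact: w0|exact: fM].
have ME : M = 0.
  have T0 : 0 <= \int[mu]_(y in D) (w y * psi y) by exact: integral_ge0.
  move: Mle T0 M0 theta1 Mfin; case: M {Moo fM} => [M| |]//.
  case: (\int[mu]_(y in D) (w y * psi y)) => [t| |]//.
  rewrite -EFinM !lee_fin !lte_fin => Mt t0 M0 t1 _; congr EFin; nra.
move=> y Dy; apply/eqP; rewrite eq_le f0// andbT.
by rewrite (le_trans (fM _ Dy))// ME mule0.
Qed.

End integral_inequalities.

(** * Last and first points where a continuous function is not positive *)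

Section extremal_nonpos.
Context {R : realType}.
Local Open Scope ring_scope.
Implicit Types (f : R -> R) (u v : R).

Lemma last_nonpos f u v : u < v ->
  (forall x, u <= x <= v -> {for x, continuous f}) -> f u <= 0 -> 0 < f v ->
  exists w, [/\ u <= w < v, f w <= 0 & forall x, w < x <= v -> 0 < f x].
Proof.
move=> uv fcont fu fv.
pose E := [set x | u <= x <= v /\ f x <= 0].
have Eu : E u by split => //; rewrite lexx ltW.
have supE : has_sup E by split; [exists u|exists v => x [/andP[]]].
have uw : u <= sup E by apply: sup_upper_bound.
have wv : sup E <= v by apply: ge_sup; [exists u|move=> x [/andP[]]].
have fw : f (sup E) <= 0.
  rewrite leNgt; apply/negP => fw.
  have := fcont (sup E); rewrite uw wv => /(_ isT)/cvgrPdist_lt/(_ _ fw).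
  move=> [d /= d0 fd]; have [x [xE fx] xd] := sup_adherent d0 supE.
  have xw : x <= sup E by apply: sup_upper_bound.
  have : `|f (sup E) - f x| < f (sup E).
    by apply: fd; rewrite /ball_/= ger0_norm ?subr_ge0//; lra.
  by move=> /ltr_normlW; lra.
exists (sup E); split => //.
- rewrite uw/= lt_neqAle wv andbT; apply/eqP => wE.
  by move: fw; rewrite wE leNgt fv.
- move=> x /andP[wx xv]; rewrite ltNge; apply/negP => fx.
  have : x <= sup E.
    by apply: sup_upper_bound => //; split=> //; rewrite xv (le_trans uw)// ltW.
  by rewrite leNgt wx.
Qed.

Lemma first_nonpos f u v : u < v ->
  (forall x, u <= x <= v -> {for x, continuous f}) -> f v <= 0 -> 0 < f u ->
  exists w, [/\ u < w <= v, f w <= 0 & forall x, u <= x < w -> 0 < f x].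
Proof.
move=> uv fcont fv fu.
have [||||w [/andP[vw wu] fw wpos]] := @last_nonpos (f \o -%R) (- v) (- u).
- by rewrite ltrN2.
- move=> x xuv; apply: continuous_comp; first exact: opp_continuous.
  by apply: fcont; rewrite lerNr lerNl andbC.
- by rewrite /= opprK.
- by rewrite /= opprK.
exists (- w); split => //; first by rewrite ltrNr wu lerNl.
move=> x /andP[ux xw]; rewrite -[x]opprK; apply: wpos.
by rewrite ltrNr xw lerN2.
Qed.

End extremal_nonpos.

(** * The homogeneous equation *)

(** The integrated form of [d/dmu (d/ds) h = h], with the [s]-derivative of [h]
    tending to 0 at [l]: that derivative at [y] is the integral of [h] over
    [(l, y)], and integrating it against [ds] over [(x', x)] gives the kernel
    [s x - s (max x' y)]. *)
Record zero_flux_solution (R : realType) (l r : \bar R) (s : R -> R)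
    (mu : {measure set R -> \bar R}) (h : R -> R) : Prop := ZeroFluxSolution {
  zfs_integrable : forall x, ooitv l r x ->
    mu.-integrable (ooitv l x%:E) (EFin \o h);
  zfs_increment : forall x' x, ooitv l r x' -> ooitv l r x -> (x' <= x)%R ->
    (h x - h x' =
     \int[mu]_(y in ooitv l x%:E) ((s x - s (Num.max x' y)) * h y))%R
}.

Section zero_flux.
Context {R : realType} (l r : \bar R) (s : R -> R)
  (mu : {measure set R -> \bar R}).
Let I := ooitv l r.
Hypothesis s_incr : forall x y, I x -> I y -> (x < y)%R -> (s x < s y)%R.
Hypothesis s_cont : {within I, continuous s}.
Local Open Scope ring_scope.

Lemma scale_homo x y : I x -> I y -> x <= y -> s x <= s y.
Proof.
move=> Ix Iy; rewrite le_eqVlt => /predU1P[->//|xy].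
exact: ltW (s_incr Ix Iy xy).
Qed.

Lemma measurable_scale : measurable_fun I s.
Proof.
by apply: subspace_continuous_measurable_fun => //; exact: measurable_ooitv.
Qed.

Lemma measurable_scale_max D x : measurable D -> D `<=` I -> I x ->
  measurable_fun D (fun y => s (Num.max x y)).
Proof.
move=> mD DI Ix; apply: (measurable_comp (F := I)).
- exact: measurable_ooitv.
- by move=> _ [y /DI Iy <-]; exact: ooitv_max.
- exact: measurable_scale.
- by apply: measurable_maxr; [exact: measurable_cst|exact: measurable_id].
Qed.

Lemma scale_continuous_at x : I x -> {for x, continuous s}.
Proof.
move=> Ix; move: s_cont; rewrite continuous_open_subspace; last first.
  exact: open_ooitv.
by move=> /(_ x); apply; rewrite inE.
Qed.

Lemma scale_increment_lt x z e : I x -> I z -> x < z -> 0 < e ->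
  exists2 y, x < y <= z & s y - s x < e.
Proof.
move=> Ix Iz xz e0.
have /cvgrPdist_lt /(_ _ e0) [d /= d0 sd] := scale_continuous_at Ix.
pose y := Num.min z (x + d / 2).
have xy : x < y by rewrite lt_min xz/= ltrDl divr_gt0.
have yz : y <= z by rewrite ge_min lexx.
exists y; [by rewrite xy yz|have := sd y].
rewrite /ball_/= => syd.
have : `|s x - s y| < e; last by rewrite distrC => /ltr_normlW.
apply: syd; rewrite distrC gtr0_norm ?subr_gt0//.
have : y <= x + d / 2 by rewrite ge_min lexx orbT.
by lra.
Qed.

Lemma integral_kernel_bounds x' x y : I x' -> I x -> x' <= x ->
  ooitv l x%:E y -> 0 <= s x - s (Num.max x' y) <= s x - s x'.
Proof.
move=> Ix' Ix x'x yx; have Iy : I y by exact: sub_ooitv Ix.2 _ yx.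
have Im : I (Num.max x' y) by exact: ooitv_max.
apply/andP; split.
  rewrite subr_ge0; apply: scale_homo => //; rewrite ge_max x'x/=.
  by apply: ltW; rewrite -lte_fin; exact: yx.2.
by rewrite lerD2l lerN2; apply: scale_homo => //; rewrite le_max lexx.
Qed.

Variable h : R -> R.

Hypothesis zfs : zero_flux_solution l r s mu h.
Let N x := \int[mu]_(y in ooitv l x%:E) `|h y|.
Let D x := \int[mu]_(y in ooitv l x%:E) h y.

Lemma integrable_kernel x' x : I x' -> I x -> x' <= x ->
  mu.-integrable (ooitv l x%:E)
    (EFin \o (fun y => (s x - s (Num.max x' y)) * h y)).
Proof.
move=> Ix' Ix x'x.
have mD := measurable_ooitv l x%:E; have DI := sub_ooitv Ix.2.
have mh := measurable_int _ (zfs_integrable zfs Ix).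
apply: (@le_integrable _ _ _ _ _ _ _
  (EFin \o (fun y => (s x - s x') * h y))) => //.
- apply/measurable_EFinP; apply: measurable_funM; last exact/measurable_EFinP.
  by apply: measurable_funB => //; exact: measurable_scale_max.
- move=> y Dy /=; rewrite lee_fin !normrM ler_wpM2r//.
  have /andP[k0 kle] := integral_kernel_bounds Ix' Ix x'x Dy.
  by rewrite ger0_norm// (le_trans kle)// ler_norm.
- exact: (integrableZl mD (s x - s x') (zfs_integrable zfs Ix)).
Qed.

Lemma increment_bound x' x : I x' -> I x -> x' <= x ->
  `|h x - h x'| <= (s x - s x') * N x.
Proof.
move=> Ix' Ix x'x; rewrite (zfs_increment zfs)//.
have mD := measurable_ooitv l x%:E; have ih := zfs_integrable zfs Ix.
have ik := integrable_kernel Ix' Ix x'x.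
apply: le_trans (le_normr_Rintegral mD ik) _.
rewrite /N -RintegralZl//; last exact: integrable_norm.
apply: le_Rintegral => //.
- exact: integrable_norm.
- exact: (integrableZl mD (s x - s x') (integrable_norm ih)).
move=> y Dy; rewrite normrM ler_wpM2r//.
have /andP[k0 kle] := integral_kernel_bounds Ix' Ix x'x Dy.
by rewrite ger0_norm.
Qed.

Lemma variation_le x y : I x -> I y -> x <= y -> N x <= N y.
Proof.
move=> Ix Iy xy.
have iy := integrable_norm (zfs_integrable zfs Iy).
rewrite /N /Rintegral fine_le//.
- apply: integrable_fin_num; first exact: measurable_ooitv.
  exact: integrable_norm (zfs_integrable zfs Ix).
- by apply: integrable_fin_num => //; exact: measurable_ooitv.
apply: ge0_subset_integral => //; try exact: measurable_ooitv.
- exact: measurable_int iy.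
- exact: sub_ooitv_real.
Qed.

Lemma zfs_continuous x : I x -> {for x, continuous h}.
Proof.
move=> Ix; have [u Iu xu] := ooitv_right Ix.
have N0 : 0 <= N u by apply: Rintegral_ge0.
have hle y z : I y -> I z -> y <= z -> z <= u ->
    `|h z - h y| <= (s z - s y) * N u.
  move=> Iy Iz yz zu; apply: le_trans (increment_bound Iy Iz yz) _.
  by rewrite ler_wpM2l ?subr_ge0 ?scale_homo// variation_le.
apply/cvgrPdist_lt => e e0.
have e1 : 0 < e / (N u + 1) by rewrite divr_gt0// ltr_wpDl.
have := scale_continuous_at Ix => /cvgrPdist_lt /(_ _ e1) sx.
have nI : \forall y \near x, I y.
  by apply: open_nbhs_nbhs; split => //; exact: open_ooitv.
have nu : \forall y \near x, y < u.
  by apply: open_nbhs_nbhs; split => //; exact: open_lt.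
near=> y.
have Iy : I y by near: y.
have yu : y <= u by apply: ltW; near: y.
have sy : `|s x - s y| < e / (N u + 1) by near: y.
apply: (@le_lt_trans _ _ (`|s x - s y| * N u)).
  case: (leP y x) => [yx|/ltW xy].
    by rewrite [X in _ <= X * _]ger0_norm ?subr_ge0 ?scale_homo// hle// ltW.
  rewrite distrC [X in _ <= X * _]distrC.
  by rewrite [X in _ <= X * _]ger0_norm ?subr_ge0 ?scale_homo// hle.
apply: (@le_lt_trans _ _ (e / (N u + 1) * N u)).
  by rewrite ler_wpM2r// ltW.
by rewrite mulrAC ltr_pdivrMr ?ltr_wpDl// ltr_pM2l// ltrDl.
Unshelve. all: by end_near.
Qed.

(** Where [h] is nonnegative, its [s]-derivative, the integral of [h] up to the
    current point, increases: once nonnegative at [x1] it stays so. *)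
Lemma nondecreasing_while_ge0 x1 x2 : I x1 -> I x2 -> x1 <= x2 -> 0 <= D x1 ->
  (forall y, x1 <= y < x2 -> 0 <= h y) -> h x1 <= h x2.
Proof.
move=> Ix1 Ix2 x12 D0 hge0; rewrite -subr_ge0 (zfs_increment zfs)//.
have ik := integrable_kernel Ix1 Ix2 x12.
have split_itv := ooitv_split Ix1.1 x12.
rewrite split_itv Rintegral_setU//; last 3 first.
- exact: measurable_ooitv.
- by rewrite -split_itv.
- exact: ooitv_split_disj.
apply: addr_ge0.
  have -> : \int[mu]_(y in ooitv l x1%:E) ((s x2 - s (Num.max x1 y)) * h y) =
      \int[mu]_(y in ooitv l x1%:E) ((s x2 - s x1) * h y).
    apply: eq_Rintegral => y; rewrite inE => -[_]; rewrite lte_fin => yx1.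
    by rewrite max_l// ltW.
  rewrite RintegralZl; last 2 first.
  - exact: measurable_ooitv.
  - exact: (zfs_integrable zfs Ix1).
  by apply: mulr_ge0 => //; rewrite subr_ge0 scale_homo.
apply: Rintegral_ge0 => y /=; rewrite in_itv/= => yx.
rewrite mulr_ge0 ?hge0//.
have /andP[x1y yx2] := yx.
suff : ooitv l x2%:E y.
  by move=> /(integral_kernel_bounds Ix1 Ix2 x12) /andP[].
by rewrite split_itv; right; rewrite /= in_itv.
Qed.

Lemma flux_ge0_of_increase x0 x1 : I x0 -> I x1 -> x0 < x1 ->
  (forall y, x0 < y < x1 -> 0 <= h y) -> h x0 <= h x1 -> 0 <= D x1.
Proof.
move=> Ix0 Ix1 x01 hge0 h01.
have s01 : 0 < s x1 - s x0 by rewrite subr_gt0 s_incr.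
rewrite -(pmulr_rge0 _ s01) /D -RintegralZl//; last 2 first.
- exact: measurable_ooitv.
- exact: (zfs_integrable zfs Ix1).
apply: (@le_trans _ _ (h x1 - h x0)); first by rewrite subr_ge0.
rewrite (zfs_increment zfs)//; last exact: ltW.
apply: le_Rintegral => //.
- exact: measurable_ooitv.
- exact: integrable_kernel (ltW x01).
- exact: (integrableZl (measurable_ooitv _ _) _ (zfs_integrable zfs Ix1)).
move=> y yx1 /=.
have /andP[_] := integral_kernel_bounds Ix0 Ix1 (ltW x01) yx1.
have [//|x0y kle] := leP y x0.
by rewrite ler_wpM2r// hge0// x0y -lte_fin; exact: yx1.2.
Qed.

Lemma zfs_opp : zero_flux_solution l r s mu (fun x => - h x).
Proof.
split=> [x Ix|x' x Ix' Ix x'x].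
  rewrite (_ : EFin \o _ = -%E \o (EFin \o h))//.
  exact: (integrableN (zfs_integrable zfs Ix)).
rewrite -opprD (zfs_increment zfs)// -mulN1r -RintegralZl//.
- by apply: eq_Rintegral => y _; rewrite mulN1r mulrN.
- exact: measurable_ooitv.
- exact: integrable_kernel.
Qed.



(** A maximum principle. If [h x > 0] with [x < c], let [w] be the first point
    after [x] where [h] is no longer positive. Going left from [x], either [h]
    is positive all the way to [l], or it rises to [h x] from a last point
    where it is nonpositive; in both cases the flux at [x] is nonnegative, so
    that [h] cannot decrease between [x] and [w]. *)
Lemma zfs_le0_left c : I c -> h c <= 0 ->
  forall x, I x -> x <= c -> h x <= 0.
Proof.
move=> Ic hc x Ix; rewrite le_eqVlt => /predU1P[->//|xc].
rewrite leNgt; apply/negP => hx.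
have cont u v : I u -> I v -> forall y, u <= y <= v -> {for y, continuous h}.
  move=> Iu Iv y /andP[uy yv]; apply: zfs_continuous.
  exact: ooitv_between Iu Iv uy yv.
have Dx : 0 <= D x.
  have [[u [Iu ux hu]]|] := pselect (exists u, [/\ I u, u < x & h u <= 0]).
    have [w [/andP[uw wx] hw wpos]] := last_nonpos ux (cont u x Iu Ix) hu hx.
    have Iw : I w by exact: ooitv_between Iu Ix uw (ltW wx).
    apply: flux_ge0_of_increase Iw Ix wx _ (le_trans hw (ltW hx)).
    by move=> y /andP[wy yx]; rewrite ltW// wpos// wy ltW.
  move=> hpos; apply: Rintegral_ge0 => y [ly yx]; rewrite leNgt.
  apply/negP => hy; apply: hpos; exists y; split; last exact: ltW.
    by split => //; exact: lt_trans yx Ix.2.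
  by rewrite -lte_fin.
have [w [/andP[xw wc] hw wpos]] := first_nonpos xc (cont x c Ix Ic) hc hx.
have Iw : I w by exact: ooitv_between Ix Ic (ltW xw) wc.
have := nondecreasing_while_ge0 Ix Iw (ltW xw) Dx.
rewrite leNgt (le_lt_trans hw hx) => /(_ _)/negP; apply => //.
by move=> y /wpos /ltW.
Qed.

(** Gronwall to the right: on [(p, x)] the increment bound has the factor
    [(s x - s p) * mu (p, x)], which is less than 1 for [x] close to [p], so
    that an interval of zeros starting at [l] cannot end at a point [p] of
    [(l, r)]. *)
Lemma zfs_eq0_right c : radon_on l r mu -> I c ->
  (forall x, I x -> x <= c -> h x = 0) -> forall x, I x -> h x = 0.
Proof.
move=> mu_radon Ic h0 z Iz; have [/h0 ->//|cz] := leP z c.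
pose E := [set x | c <= x <= z /\ forall y, I y -> y <= x -> h y = 0].
have Ec : E c by split; [rewrite lexx ltW|exact: h0].
have supE : has_sup E.
  by split; [exists c|exists z => x [/andP[]]].
pose p := sup E.
have cp : c <= p by apply: sup_upper_bound.
have pz : p <= z by apply: ge_sup; [exists c|move=> x [/andP[]]].
have Ip : I p by exact: ooitv_between Ic Iz cp pz.
have hltp y : I y -> y < p -> h y = 0.
  move=> Iy yp; have e0 : 0 < p - y by rewrite subr_gt0.
  have [x [_ Ex]] := sup_adherent e0 supE.
  by rewrite -/p subKr => yx; apply: Ex => //; exact: ltW.
have hp y : I y -> y <= p -> h y = 0.
  move=> Iy; rewrite le_eqVlt => /predU1P[->|]; last exact: hltp.
  have := zfs_increment zfs Ic Ip cp; rewrite [h c]h0// subr0 => ->.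
  rewrite (_ : Rintegral _ _ _ = \int[mu]_(y in ooitv l p%:E) 0).
    by rewrite Rintegral_cst ?mul0r//; exact: measurable_ooitv.
  apply: eq_Rintegral => t; rewrite inE => tp.
  rewrite (hltp t) ?mulr0//; first exact: sub_ooitv Ip.2 _ tp.
  by rewrite -lte_fin; exact: tp.2.
move: pz; rewrite le_eqVlt => /predU1P[pz|pz]; first by rewrite hp// pz.
have Koo : (mu `[p, z]%classic < +oo)%E.
  by apply: mu_radon; [exact: Ip.1|exact: Iz.2].
pose K := fine (mu `[p, z]%classic).
have KE : (mu `[p, z]%classic = K%:E)%E by rewrite fineK// ge0_fin_numE.
have K0 : 0 <= K by rewrite fine_ge0.
have e0 : 0 < (K + 1)^-1 by rewrite invr_gt0 ltr_wpDl.
have [x /andP[px xz] spx] := scale_increment_lt Ip Iz pz e0.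
have Ix : I x by exact: ooitv_between Ip Iz (ltW px) xz.
have spx0 : 0 <= s x - s p by rewrite subr_ge0 scale_homo// ltW.
have mD := measurable_ooitv l x%:E.
have ih := integrable_norm (zfs_integrable zfs Ix).
have mA := measurable_itv `]p, x[%R.
pose psi y := ((s x - s p) * \1_(`]p, x[%classic) y)%:E.
have psi0 y : (0 <= psi y)%E by rewrite lee_fin mulr_ge0.
have mpsi : measurable_fun (ooitv l x%:E) psi.
  by apply/measurable_EFinP; apply: measurable_funM => //;
    exact: measurable_indic.
have ME : (\int[mu]_(y in ooitv l x%:E) (1 * `|h y|%:E) = (N x)%:E)%E.
  under eq_integral do rewrite mul1e.
  rewrite /N /Rintegral fineK//; exact: (integrable_fin_num mD ih).
have hbound y : ooitv l x%:E y -> (`|h y|%:E <= psi y * (N x)%:E)%E.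
  move=> yx; have Iy : I y by exact: sub_ooitv Ix.2 _ yx.
  have ylex : y <= x by apply: ltW; rewrite -lte_fin; exact: yx.2.
  have N0 : 0 <= N x by exact: Rintegral_ge0.
  have [yp|py] := leP y p.
    by rewrite hp// normr0 -EFinM lee_fin !mulr_ge0.
  rewrite -EFinM lee_fin indicE mem_set ?mulr1; last first.
    by rewrite /= in_itv/= py -lte_fin; exact: yx.2.
  have := increment_bound Ip Iy (ltW py); rewrite (hp p)// subr0.
  move=> /le_trans; apply; apply: ler_pM.
  - by rewrite subr_ge0 scale_homo// ltW.
  - exact: Rintegral_ge0.
  - by rewrite lerD2r scale_homo.
  - exact: variation_le.
have psi1 : (\int[mu]_(y in ooitv l x%:E) (1 * psi y) < 1)%E.
  under eq_integral do rewrite mul1e /psi EFinM.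
  rewrite ge0_integralZl_EFin//; last first.
    by apply/measurable_EFinP; exact: measurable_indic.
  rewrite integral_indic//.
  apply: (@le_lt_trans _ _ ((s x - s p)%:E * K%:E)%E).
    apply: lee_wpmul2l => //; rewrite -KE; apply: le_measure; rewrite ?inE//.
      exact: measurableI.
    move=> t [/= + _]; rewrite !in_itv/= => /andP[pt tx].
    by rewrite (ltW pt) (le_trans (ltW tx)).
  rewrite -EFinM lte_fin; apply: (@le_lt_trans _ _ ((K + 1)^-1 * K)).
    by rewrite ler_wpM2r// ltW.
  by rewrite ltr_pdivrMl ?ltr_wpDl// mulr1 ltrDl.
have h0x y : ooitv l x%:E y -> h y = 0.
  move=> yx; suff : `|h y|%:E = 0%E.
    by move=> [] /eqP; rewrite normr_eq0 => /eqP.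
  apply: (weighted_gronwall (mu := mu) (w := fun=> 1%E) (psi := psi)
    (f := fun y => `|h y|%:E) mD) yx => //.
  - exact: measurable_int ih.
  - by rewrite ME ltry.
  - by move=> t tx; rewrite ME; exact: hbound.
suff : E (p + (x - p) / 2) by move=> /(sup_upper_bound supE); rewrite -/p; lra.
split; first by apply/andP; split; lra.
move=> y Iy yx; apply: h0x; split; first exact: Iy.1.
by rewrite lte_fin; lra.
Qed.

End zero_flux.

(** * Tonelli on a one-sided neighbourhood of the left end point *)

Section tonelli_left.
Context {R : realType} (l : \bar R) (b : R).
Let I := ooitv l b%:E.
Let mI : measurable I := measurable_ooitv l b%:E.
Implicit Types mu nu : {measure set R -> \bar R}.

Definition finite_away_left mu :=
  forall a : R, I a -> mu `]a, b[%classic < +oo.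

Lemma sigma_finite_restr_ooitv mu : l < b%:E -> finite_away_left mu ->
  sigma_finite setT (mrestr mu mI).
Proof.
move=> lb mufin; have [a [aI _ acvg]] := ooitv_left_seq lb.
exists (fun n => ~` I `|` `]a n, b[%classic).
  apply/seteqP; split => // y _; have [Iy|nIy] := pselect (I y); last first.
    by exists 0%N => //; left.
  have [n any] := acvg _ Iy.1; exists n => //; right.
  by rewrite /= in_itv/= any -lte_fin; exact: Iy.2.
move=> n; split.
  by apply: measurableU; [exact: measurableC|exact: measurable_itv].
apply: le_lt_trans (mufin _ (aI n)); apply: le_measure; rewrite ?inE.
- apply: measurableI => //.
  by apply: measurableU; [exact: measurableC|exact: measurable_itv].
- exact: measurable_itv.
- by move=> y [[|//]].
Qed.

(** Both integrals are the product mass of the triangle [l < z < y < b]; the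
    restrictions of [mu] and [nu] to [(l, b)] are sigma-finite even when their
    mass is infinite near [l]. *)
Lemma tonelli_ooitv mu nu : l < b%:E ->
  finite_away_left mu -> finite_away_left nu ->
  [/\ measurable_fun I (fun z => mu `]z, b[%classic),
      measurable_fun I (fun y => nu (ooitv l y%:E)) &
  \int[nu]_(z in I) mu `]z, b[%classic = \int[mu]_(y in I) nu (ooitv l y%:E)].
Proof.
move=> lb mufin nufin.
pose mu' : {sigma_finite_measure set R -> \bar R} := HB.pack (mrestr mu mI)
  (Measure_isSigmaFinite.Build _ _ _ (mrestr mu mI)
    (sigma_finite_restr_ooitv lb mufin)).
pose nu' : {sigma_finite_measure set R -> \bar R} := HB.pack (mrestr nu mI)
  (Measure_isSigmaFinite.Build _ _ _ (mrestr nu mI)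
    (sigma_finite_restr_ooitv lb nufin)).
pose A : set (R * R) := [set zy | (zy.1 < zy.2)%R] `&` (I `*` I).
have mA : measurable A.
  apply: measurableI; last exact: measurableX.
  rewrite (_ : mkset _ = (fun zy => zy.2 - zy.1)%R @^-1` `]0%R, +oo[%classic).
    rewrite -[X in measurable X]setTI.
    have : measurable_fun [set: R * R] (fun zy : R * R => zy.2 - zy.1)%R.
      by apply: measurable_funB; [exact: measurable_snd|exact: measurable_fst].
    by apply => //; exact: measurable_itv.
  by apply/seteqP; split => -[z y]; rewrite /= in_itv/= andbT subr_gt0.
have nuE : nu' \o ysection A = (fun y => nu (ooitv l y%:E)) \_ I.
  apply/funext => y /=; rewrite /nu' patchE /= /mrestr; case: ifPn.
    rewrite inE => -[ly yb]; congr (nu _); apply/seteqP; split => z /=.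
      rewrite /ysection/= inE => -[[zy [[lz zb] _]] _].
      by split; rewrite ?lte_fin.
    move=> [lz zy]; have zb : z%:E < b%:E by exact: lt_trans yb.
    by split => //; rewrite /ysection/= inE; split => //; rewrite /= -lte_fin.
  rewrite notin_setE => nIy; rewrite (_ : _ `&` _ = set0) ?measure0//.
  by apply/seteqP; split => // z [] /=; rewrite /ysection/= inE => -[_ []].
have muE : mu' \o xsection A = (fun z => mu `]z, b[%classic) \_ I.
  apply/funext => z /=; rewrite /mu' patchE /= /mrestr; case: ifPn.
    rewrite inE => -[lz zb]; congr (mu _); apply/seteqP; split => y /=.
      rewrite /xsection/= inE in_itv/= => -[[/= zy _] [ly yb]].
      by rewrite zy -lte_fin.
    rewrite in_itv/= => /andP[zy yb].
    have Iy : I y by split; [exact: lt_trans lz _|rewrite lte_fin].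
    by split => //; rewrite /xsection/= inE.
  rewrite notin_setE => nIz; rewrite (_ : _ `&` _ = set0) ?measure0//.
  by apply/seteqP; split => // y [] /=; rewrite /xsection/= inE => -[_ []].
have restrE (m : {measure set R -> \bar R}) f :
    \int[mrestr m mI]_(y in I) f y = \int[m]_(y in I) f y.
  by apply: eq_measure_integral => B mB BI; rewrite /= /mrestr setIidl.
split.
- by apply/(measurable_restrictT _ mI); rewrite -muE;
    exact: measurable_fun_xsection.
- by apply/(measurable_restrictT _ mI); rewrite -nuE;
    exact: measurable_fun_ysection.
rewrite -[LHS]restrE -[RHS]restrE integral_mkcond [RHS]integral_mkcond.
rewrite -muE -nuE.
have := indic_fubini_tonelli nu' mu' mA.
by rewrite (indic_fubini_tonelli_FE mu' mA) (indic_fubini_tonelli_GE nu' mA).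
Qed.

End tonelli_left.

(** * Integral equations with a kernel *)

Record kernel_solution (R : realType) (l r : \bar R)
    (mu : {measure set R -> \bar R}) (k : R -> R -> R) (h : R -> R) : Prop :=
  KernelSolution {
  ks_integrable : forall x, ooitv l r x ->
    mu.-integrable (ooitv l r) (EFin \o (fun y => k x y * h y)%R);
  ks_eq : forall x, ooitv l r x ->
    (h x = \int[mu]_(y in ooitv l r) (k x y * h y))%R
}.

Section kernel_to_zero_flux.
Context {R : realType} (l r : \bar R) (s : R -> R)
  (mu : {measure set R -> \bar R}).
Let I := ooitv l r.
Hypothesis s_incr : forall x y, I x -> I y -> (x < y)%R -> (s x < s y)%R.
Hypothesis s_cont : {within I, continuous s}.
Local Open Scope ring_scope.

(** The kernels of interest have this form, with [q = Num.max c] when [c] is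
    interior and [q = id] when [c = l]. The term in [q] cancels in increments of
    [h]. The bound on [q] keeps the kernel at a point far enough to the right
    away from 0 on [(l, x)], which makes [h] itself integrable there. *)
Lemma zero_flux_of_kernel (q h : R -> R) :
  measurable_fun setT q -> (forall y, I y -> I (q y)) ->
  (forall x, I x -> exists2 u, I u & forall y, I y -> y < x -> q y <= u) ->
  kernel_solution l r mu (fun x y => s (Num.max x y) - s (q y)) h ->
  zero_flux_solution l r s mu h.
Proof.
move=> mq qI qu [hint heq].
have mI : measurable I by exact: measurable_ooitv.
have hi x : I x -> mu.-integrable (ooitv l x%:E) (EFin \o h).
  move=> Ix; have [u Iu xu] := qu x Ix.
  have [x' Ix' ux'] := ooitv_right (ooitv_max Ix Iu).
  have mD := measurable_ooitv l x%:E; have DI := sub_ooitv (l := l) Ix.2.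
  move: (ux'); rewrite gt_max => /andP[xx' ux'2].
  pose k y := s (Num.max x' y) - s (q y).
  have d0 : 0 < s x' - s (Num.max x u).
    by rewrite subr_gt0 s_incr//; exact: ooitv_max.
  have kge y : ooitv l x%:E y -> s x' - s (Num.max x u) <= k y.
    move=> yx; have Iy := DI _ yx.
    have yltx : y < x by rewrite -lte_fin; exact: yx.2.
    rewrite /k (@max_l _ _ x'); last exact: ltW (lt_trans yltx xx').
    rewrite lerD2l lerN2; apply: (scale_homo s_incr (qI _ Iy)).
      exact: ooitv_max.
    by rewrite le_max xu// orbT.
  have mk : measurable_fun (ooitv l x%:E) k.
    apply: measurable_funB; first exact: (measurable_scale_max s_cont).
    apply: (measurable_comp (F := I)) => //.
    - by move=> _ [y /DI Iy <-]; exact: qI.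
    - exact: measurable_scale s_cont.
    - exact: measurable_funTS.
  have ikh := integrableS mI mD DI (hint _ Ix').
  have mkh : measurable_fun (ooitv l x%:E) (fun y => k y * h y).
    by apply/measurable_EFinP; exact: measurable_int ikh.
  have mh : measurable_fun (ooitv l x%:E) h.
    apply: (eq_measurable_fun (fun y => (k y * h y) * k y `^ (-1))) => [y|].
      rewrite inE => /kge /(lt_le_trans d0) k0; rewrite powR_inv1 1?ltW//.
      by rewrite mulrAC divff ?mul1r// gt_eqF.
    (* [powR] provides a measurable inverse on positive reals *)
    apply: measurable_funM => //.
    exact: (measurableT_comp (measurable_powR (-1))).
  apply: (@le_integrable _ _ _ _ _ _ _ (fun y =>
    ((s x' - s (Num.max x u))^-1)%:E * (k y * h y)%:E)%E) => //.
  - exact/measurable_EFinP.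
  - move=> y yx /=; rewrite lee_fin normrM normfV normrM (gtr0_norm d0).
    rewrite ler_pdivlMl// ler_wpM2r// (le_trans (kge _ yx))//.
    exact: ler_norm.
  - exact: integrableZl ikh.
split=> // x' x Ix' Ix x'x; rewrite !heq//.
rewrite -RintegralB//; try exact: hint.
have DE : ooitv l x%:E = I `&` ooitv l x%:E.
  by rewrite setIidr//; exact: sub_ooitv Ix.2.
rewrite [in RHS]DE [RHS]Rintegral_mkcondr.
apply: eq_Rintegral => y; rewrite inE => Iy.
rewrite patchE -mulrBl; case: ifPn.
  rewrite inE => -[_]; rewrite lte_fin => yx.
  by rewrite (max_l (ltW yx)); congr (_ * _); ring.
rewrite notin_setE => nyx; have xy : x <= y.
  rewrite leNgt; apply/negP => yx; apply: nyx; split; first exact: Iy.1.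
  by rewrite lte_fin.
by rewrite !max_r// ?(le_trans x'x)// subrr mul0r.
Qed.

Lemma kernel_solution_eq0 c h : radon_on l r mu -> I c ->
  kernel_solution l r mu
    (fun x y => s (Num.max x y) - s (Num.max c y)) h ->
  forall x, I x -> h x = 0.
Proof.
move=> mu_radon Ic kh; have zfs : zero_flux_solution l r s mu h.
  apply: (zero_flux_of_kernel (q := Num.max c)) kh => //.
  - by apply: measurable_maxr => //; exact: measurable_cst.
  - by move=> y; exact: ooitv_max.
  - move=> x Ix; exists (Num.max c x); first exact: ooitv_max.
    by move=> y _ yx; rewrite ge_max !le_max lexx (ltW yx) orbT.
have hc : h c = 0.
  rewrite (ks_eq kh)//.
  rewrite (_ : Rintegral _ _ _ = \int[mu]_(y in ooitv l r) 0).
    by rewrite Rintegral_cst ?mul0r//; exact: measurable_ooitv.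
  by apply: eq_Rintegral => y _; rewrite subrr mul0r.
apply: (zfs_eq0_right s_incr s_cont zfs mu_radon Ic) => x Ix xc.
apply/eqP; rewrite eq_le (zfs_le0_left s_incr s_cont zfs Ic) ?hc//=.
rewrite -oppr_le0.
by apply: (zfs_le0_left s_incr s_cont (zfs_opp s_incr s_cont zfs) Ic);
  rewrite ?hc ?oppr0.
Qed.

End kernel_to_zero_flux.

(** * The equation based at a left end point that is not natural *)

Section left_end.
Context {R : realType} (l r : \bar R) (s : R -> R)
  (mu : {measure set R -> \bar R}).
Let I := ooitv l r.
Hypothesis s_incr : forall x y, I x -> I y -> (x < y)%R -> (s x < s y)%R.
Hypothesis s_cont : {within I, continuous s}.
Variable h : R -> R.
Hypothesis kh : kernel_solution l r mu (fun x y => s (Num.max x y) - s y)%R h.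

Let zfs : zero_flux_solution l r s mu h.
Proof.
apply: (zero_flux_of_kernel s_incr s_cont (q := id)) kh => //.
by move=> x Ix; exists x => // y _ /ltW.
Qed.

Lemma left_end_integrable x : I x ->
  mu.-integrable (ooitv l x%:E) (EFin \o (fun y => (s x - s y) * h y)%R).
Proof.
move=> Ix; have mD := measurable_ooitv l x%:E.
have := integrableS (measurable_ooitv l r) mD (sub_ooitv Ix.2)
  (ks_integrable kh Ix).
apply: eq_integrable => // y; rewrite inE => -[_]; rewrite lte_fin => yx /=.
by rewrite (max_l (ltW yx)).
Qed.

Lemma left_end_eq x : I x ->
  (h x)%:E = \int[mu]_(y in ooitv l x%:E) ((s x - s y) * h y)%:E.
Proof.
move=> Ix; rewrite (ks_eq kh)// /Rintegral fineK; last first.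
  exact: (integrable_fin_num (measurable_ooitv _ _) (ks_integrable kh Ix)).
have DE : ooitv l x%:E = I `&` ooitv l x%:E.
  by rewrite setIidr//; exact: sub_ooitv Ix.2.
rewrite [in RHS]DE [RHS]integral_mkcondr; apply: eq_integral => y.
rewrite inE => Iy; rewrite patchE; case: ifPn.
  by rewrite inE => -[_]; rewrite lte_fin => yx; rewrite (max_l (ltW yx)).
rewrite notin_setE => nyx; have xy : (x <= y)%R.
  rewrite leNgt; apply/negP => yx; apply: nyx; split; first exact: Iy.1.
  by rewrite lte_fin.
by rewrite max_r// subrr mul0r.
Qed.

Lemma scale_increment_ge0 x y : I x -> ooitv l x%:E y -> (0 <= s x - s y)%R.
Proof.
move=> Ix yx; have Iy : I y by exact: sub_ooitv Ix.2 _ yx.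
by rewrite subr_ge0 (scale_homo s_incr)// ltW// -lte_fin; exact: yx.2.
Qed.

Lemma left_end_bound x : I x ->
  `|h x|%:E <= \int[mu]_(y in ooitv l x%:E) ((s x - s y)%:E * `|h y|%:E).
Proof.
move=> Ix; have mD := measurable_ooitv l x%:E.
rewrite -abse_EFin left_end_eq//.
have mk := measurable_int mu (left_end_integrable Ix).
apply: le_trans (le_abse_integral mu mD mk) _.
rewrite le_eqVlt; apply/orP; left; apply/eqP; apply: eq_integral => y.
by rewrite inE => yx /=; rewrite normrM ger0_norm ?EFinM// scale_increment_ge0.
Qed.

Let measurable_abs x : I x ->
  measurable_fun (ooitv l x%:E) (fun y => `|h y|%:E).
Proof.
by move=> Ix; exact: measurable_int (integrable_norm (zfs_integrable zfs Ix)).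
Qed.

Let measurable_increment x : I x ->
  measurable_fun (ooitv l x%:E) (fun y => (s x - s y)%:E).
Proof.
move=> Ix; apply/measurable_EFinP; apply: measurable_funB => //.
apply: measurable_funS (measurable_scale s_cont); first exact: measurable_ooitv.
exact: sub_ooitv Ix.2.
Qed.

(** Gronwall for [\int_(l, c) (s c - s t) |h t|]: this integral bounds [|h y|]
    for [y < c] because the kernel increases with its base point. *)
Lemma left_end_eq0_of_scale b : I b ->
  \int[mu]_(y in ooitv l b%:E) (s b - s y)%:E < +oo ->
  exists2 c, I c & forall y, ooitv l c%:E y -> h y = 0%R.
Proof.
move=> Ib boo; have [c cb c1] : exists2 c, ooitv l b%:E c &
    \int[mu]_(y in ooitv l c%:E) (s b - s y)%:E < 1.
  apply: small_integral_left => //; first exact: Ib.1.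
  - exact: measurable_increment.
  - by move=> y yb; rewrite lee_fin scale_increment_ge0.
have Ic : I c by exact: sub_ooitv Ib.2 _ cb.
have cltb : (c < b)%R by rewrite -lte_fin; exact: cb.2.
exists c => // y yc; suff : `|h y|%:E = 0.
  by move=> [] /eqP; rewrite normr_eq0 => /eqP.
have mD := measurable_ooitv l c%:E.
apply: (weighted_gronwall (mu := mu) (w := fun y => (s c - s y)%:E)
  (psi := fun=> 1) (f := fun y => `|h y|%:E) mD) yc => //.
- exact: measurable_increment.
- exact: measurable_abs.
- by move=> t tc; rewrite lee_fin scale_increment_ge0.
- have /integrableP[_] := left_end_integrable Ic.
  apply: le_lt_trans; rewrite le_eqVlt; apply/orP; left; apply/eqP.
  apply: eq_integral => t; rewrite inE => tc /=.
  by rewrite normrM ger0_norm ?EFinM// scale_increment_ge0.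
- move=> t tc; rewrite mul1e; have It : I t by exact: sub_ooitv Ic.2 _ tc.
  have tltc : (t < c)%R by rewrite -lte_fin; exact: tc.2.
  have mT := measurable_ooitv l t%:E.
  have sub_tc : ooitv l t%:E `<=` ooitv l c%:E.
    exact: sub_ooitv_real (ltW tltc).
  apply: le_trans (left_end_bound It) _.
  apply: (@le_trans _ _ (\int[mu]_(y in ooitv l t%:E)
      ((s c - s y)%:E * `|h y|%:E))).
    apply: ge0_le_integral => //.
    + by move=> u ut; rewrite mule_ge0// lee_fin scale_increment_ge0.
    + apply: emeasurable_funM; first exact: measurable_increment.
      exact: measurable_abs.
    + apply: measurable_funS sub_tc _ => //.
      apply: emeasurable_funM; first exact: measurable_increment.
      exact: measurable_abs.
    + move=> u ut; rewrite lee_wpmul2r// lee_fin lerD2r.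
      by rewrite (scale_homo s_incr)// ltW.
  apply: ge0_subset_integral => //.
  + apply: emeasurable_funM; first exact: measurable_increment.
    exact: measurable_abs.
  + by move=> u uc; rewrite mule_ge0// lee_fin scale_increment_ge0.
- under eq_integral do rewrite mule1.
  apply: le_lt_trans c1; apply: ge0_le_integral => //.
  + by move=> u uc; rewrite lee_fin scale_increment_ge0.
  + exact: measurable_increment.
  + by apply: measurable_funS (measurable_increment Ib);
      [exact: measurable_ooitv|exact: sub_ooitv_real (ltW cltb)].
  + by move=> u uc; rewrite lee_fin lerD2r (scale_homo s_incr)// ltW.
Qed.

(** Here [|h y| <= nu (l, y) * \int_(l, c) |h|] because the increment
    [s y - s t] is the [nu]-mass of [(t, y)]. *)
Lemma left_end_eq0_of_mass (nu : {measure set R -> \bar R}) b : I b ->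
  (forall u v, I u -> I v -> (u <= v)%R ->
    nu `]u, v[%classic = (s v - s u)%:E) ->
  measurable_fun (ooitv l b%:E) (fun y => nu (ooitv l y%:E)) ->
  \int[mu]_(y in ooitv l b%:E) nu (ooitv l y%:E) < +oo ->
  exists2 c, I c & forall y, ooitv l c%:E y -> h y = 0%R.
Proof.
move=> Ib nuE mnu boo.
have [c cb c1] :=
  small_integral_left Ib.1 mnu (fun y _ => measure_ge0 nu _) boo.
have Ic : I c by exact: sub_ooitv Ib.2 _ cb.
have cltb : (c < b)%R by rewrite -lte_fin; exact: cb.2.
exists c => // y yc; suff : `|h y|%:E = 0.
  by move=> [] /eqP; rewrite normr_eq0 => /eqP.
have mD := measurable_ooitv l c%:E.
have ME : \int[mu]_(y in ooitv l c%:E) (1 * `|h y|%:E) =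
    \int[mu]_(y in ooitv l c%:E) `|h y|%:E.
  by apply: eq_integral => t _; rewrite mul1e.
apply: (weighted_gronwall (mu := mu) (w := fun=> 1)
  (psi := fun y => nu (ooitv l y%:E)) (f := fun y => `|h y|%:E) mD) yc => //.
- apply: measurable_funS mnu; first exact: measurable_ooitv.
  exact: sub_ooitv_real (ltW cltb).
- exact: measurable_abs.
- rewrite ME; have /integrableP[_] := zfs_integrable zfs Ic.
  exact: le_lt_trans.
- rewrite ME => t tc; have It : I t by exact: sub_ooitv Ic.2 _ tc.
  have tltc : (t < c)%R by rewrite -lte_fin; exact: tc.2.
  have mT := measurable_ooitv l t%:E.
  apply: le_trans (left_end_bound It) _.
  apply: (@le_trans _ _ (\int[mu]_(y in ooitv l t%:E)
      (nu (ooitv l t%:E) * `|h y|%:E))).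
    apply: ge0_le_integral => //.
    + by move=> u ut; rewrite mule_ge0// lee_fin scale_increment_ge0.
    + apply: emeasurable_funM; first exact: measurable_increment.
      exact: measurable_abs.
    + by apply: emeasurable_funM => //; exact: measurable_abs.
    + move=> u ut; have Iu : I u by exact: sub_ooitv It.2 _ ut.
      have ultt : (u < t)%R by rewrite -lte_fin; exact: ut.2.
      rewrite lee_wpmul2r// -nuE ?(ltW ultt)//.
      apply: le_measure; rewrite ?inE//.
      move=> v /=; rewrite in_itv/= => /andP[uv vt].
      by split; [exact: lt_trans ut.1 _|rewrite lte_fin].
  rewrite ge0_integralZl//; last exact: measurable_abs.
  apply: lee_wpmul2l => //; apply: ge0_subset_integral => //.
  + exact: measurable_abs.
  + exact: sub_ooitv_real (ltW tltc).
- by under eq_integral do rewrite mul1e.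
Qed.

End left_end.

(** * The measure of the scale function *)

(** The push-forward with its measure structure, which depends on the proof that
    [f] is measurable. *)
Definition image_measure d d' (T : measurableType d) (T' : measurableType d')
    (R : realType) (mu : {measure set T -> \bar R}) (f : T -> T')
    (mf : measurable_fun setT f) : {measure set T' -> \bar R} :=
  measure_function_pushforward__canonical__measure_function_Measure mu mf.

Section scale_measure.
Context {R : realType} (l r : \bar R) (s : R -> R).
Let I := ooitv l r.
Hypothesis s_incr : forall x y, I x -> I y -> (x < y)%R -> (s x < s y)%R.
Hypothesis s_cont : {within I, continuous s}.

Let scale_ltE x y : I x -> I y -> (s x < s y)%R = (x < y)%R.
Proof.
move=> Ix Iy; apply/idP/idP; last exact: s_incr.
by apply: contraTT; rewrite -!leNgt; exact: (scale_homo s_incr).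
Qed.

Let scale_leE x y : I x -> I y -> (s x <= s y)%R = (x <= y)%R.
Proof. by move=> Ix Iy; rewrite !leNgt scale_ltE. Qed.

Lemma scale_image_interval : is_interval (s @` I).
Proof.
move=> _ _ [x Ix <-] [y Iy <-] t /andP[xt ty].
have xy : (x <= y)%R by rewrite -scale_leE// (le_trans xt).
have [||z] := @IVT R s x y t xy.
- apply: continuous_subspaceW s_cont => z /=.
  by rewrite in_itv/= => /andP[]; exact: ooitv_between.
- by rewrite min_l ?max_r ?xt ?scale_leE.
- rewrite in_itv/= => /andP[xz zy] <-; exists z => //.
  exact: ooitv_between Ix Iy xz zy.
Qed.

Definition scale_inverse (t : R) : R := xget 0%R [set x | I x /\ s x = t].

Lemma scale_inverseP t : (s @` I) t ->
  I (scale_inverse t) /\ s (scale_inverse t) = t.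
Proof.
move=> [x Ix sx].
by have : [set x | I x /\ s x = t] (scale_inverse t) by exact: (@xgetI _ _ _ x).
Qed.

Let J := s @` I.
Let mJ : measurable J := is_interval_measurable scale_image_interval.

Lemma measurable_scale_inverse : measurable_fun setT (scale_inverse \_ J).
Proof.
apply/(measurable_restrictT _ mJ).
apply: (measurability (@RGenCInfty.G R)) => [|/= _ [_] [y] -> <-].
  exact: RGenCInfty.measurableE.
apply: is_interval_measurable => t u [Jt] /= yt [Ju] _ v /andP[tv vu].
have Jv : J v by apply: scale_image_interval Jt Ju _ _; rewrite tv vu.
split => //=; move: yt; rewrite !in_itv/= !andbT => /le_trans; apply.
have [It st] := scale_inverseP Jt; have [Iv sv] := scale_inverseP Jv.
by rewrite -scale_leE// st sv.
Qed.

(** Lebesgue measure on the range of [s], carried back by the inverse of [s]. *)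
Lemma ex_scale_measure :
  exists nu : {measure set R -> \bar R}, is_stieltjes l r (EFin \o s) nu.
Proof.
pose lam : {measure set (measurableTypeR R) -> \bar R} :=
  mrestr (@lebesgue_measure R) (mJ : measurable (J : set (measurableTypeR R))).
have mpsi : measurable_fun (setT : set (measurableTypeR R))
    (scale_inverse \_ J).
  exact: measurable_scale_inverse.
exists (image_measure lam mpsi); split.
- move=> u v lu uv vr; have Iv : I v.
    by split => //; apply: lt_le_trans lu _; rewrite lee_fin.
  have Iu : I u by split => //; apply: le_lt_trans vr; rewrite lee_fin.
  rewrite /image_measure /= /pushforward /lam /= /mrestr.
  rewrite (_ : _ `&` J = `]s u, s v]%classic).
    rewrite lebesgue_measure_itv/= lte_fin scale_ltE//.
    move: uv; rewrite le_eqVlt => /predU1P[->|->] /=; last by [].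
    by rewrite ltxx subee.
  apply/seteqP; split => t /=.
    move=> [] /[swap] Jt; rewrite patchE mem_set//= !in_itv/=.
    have [It st] := scale_inverseP Jt => /andP[ut tv].
    by rewrite -st scale_ltE// scale_leE// ut.
  rewrite in_itv/= => /andP[ut tv].
  have Jt : J t.
    apply: scale_image_interval (ex_intro2 _ _ u Iu erefl)
      (ex_intro2 _ _ v Iv erefl) _ _; by rewrite (ltW ut).
  split => //; rewrite patchE mem_set//= in_itv/=.
  have [It st] := scale_inverseP Jt.
  by rewrite -scale_ltE// -scale_leE// st ut.
- rewrite /image_measure /= /pushforward /lam /= /mrestr.
  rewrite (_ : _ `&` J = set0) ?measure0//; apply/seteqP; split => // t [].
  by move=> /= /[swap] Jt; rewrite patchE mem_set//= => nI;
    have [] := scale_inverseP Jt.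
Qed.

(** The half-open intervals that define a Stieltjes measure may be replaced by
    open ones, which are invariant under [x |-> - x]. *)
Lemma stieltjes_open_itv (nu : {measure set R -> \bar R}) :
  is_stieltjes l r (EFin \o s) nu ->
  forall u v, I u -> I v -> (u <= v)%R -> nu `]u, v[%classic = (s v - s u)%:E.
Proof.
move=> [nuE _] u v Iu Iv; rewrite le_eqVlt => /predU1P[->|uv].
  by rewrite set_itv_ge ?bnd_simp ?lexx// measure0 subrr.
apply/eqP; rewrite eq_le; apply/andP; split.
  rewrite EFinB -(nuE _ _ Iu.1 (ltW uv) Iv.2).
  apply: le_measure; rewrite ?inE//.
  by move=> y /=; rewrite !in_itv/= => /andP[-> /ltW].
apply/lee_addgt0Pr => e e0.
have [w /andP[uw wv] swv] : exists2 w, (u <= w < v)%R & (s v - s w < e)%R.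
  have /cvgrPdist_lt /(_ _ e0) [d /= d0 sd] := scale_continuous_at s_cont Iv.
  pose w := Num.max u (v - d / 2)%R.
  have wv : (w < v)%R by rewrite gt_max uv ltrBlDr ltrDl divr_gt0.
  exists w; first by rewrite wv le_max lexx.
  have : (`|s v - s w| < e)%R; last by move=> /ltr_normlW.
  apply: sd; rewrite /ball_/= gtr0_norm ?subr_gt0//.
  have : (v - d / 2 <= w)%R by rewrite le_max lexx orbT.
  by lra.
have Iw : I w by exact: ooitv_between Iu Iv uw (ltW wv).
apply: (@le_trans _ _ ((s w - s u)%:E + e%:E)).
  by rewrite -EFinD lee_fin; lra.
rewrite leeD2r// EFinB -(nuE _ _ Iu.1 uw Iw.2).
apply: le_measure; rewrite ?inE//.
by move=> y /=; rewrite !in_itv/= => /andP[-> /le_lt_trans ->].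
Qed.

End scale_measure.

(** * Boundary classification *)

Section tame_end.
Context {R : realType} (l r : \bar R) (s : R -> R)
  (mu : {measure set R -> \bar R}).
Let I := ooitv l r.
Hypothesis s_incr : forall x y, I x -> I y -> (x < y)%R -> (s x < s y)%R.
Hypothesis s_cont : {within I, continuous s}.

Definition interval_mass (nu : {measure set R -> \bar R}) : Prop :=
  forall u v, I u -> I v -> (u <= v)%R -> nu `]u, v[%classic = (s v - s u)%:E.

(** One of the two integrals that are infinite at a natural end point is
    finite. The measure [ds] is quantified existentially, so that the property
    is visibly invariant under reflection of the line. *)
Definition tame_left : Prop := exists b nu,
  [/\ I b, interval_mass nu &
    \int[nu]_(z in ooitv l b%:E) mu `]z, b[%classic < +oo \/
    \int[mu]_(z in ooitv l b%:E) (s b - s z)%:E < +oo].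

Definition tame_right : Prop := exists b nu,
  [/\ I b, interval_mass nu &
    \int[nu]_(z in ooitv b%:E r) mu `]b, z[%classic < +oo \/
    \int[mu]_(z in ooitv b%:E r) (s z - s b)%:E < +oo].

Let stieltjes_scale : interval_mass (stieltjes l r (EFin \o s)).
Proof.
rewrite /stieltjes; case: pselect => [e|[]]; last exact: ex_scale_measure.
exact: (stieltjes_open_itv s_cont (projT2 (cid e))).
Qed.

Lemma tame_left_of_not_natural : ~ natural_left l r s mu -> tame_left.
Proof.
apply: contra_notP => ntame b Ib.
by split; apply/eqP; rewrite -leye_eq leNgt; apply/negP => finite;
  apply: ntame; exists b, (stieltjes l r (EFin \o s)); split => //;
  [left|right].
Qed.

Lemma tame_right_of_not_natural : ~ natural_right l r s mu -> tame_right.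
Proof.
apply: contra_notP => ntame b Ib.
by split; apply/eqP; rewrite -leye_eq leNgt; apply/negP => finite;
  apply: ntame; exists b, (stieltjes l r (EFin \o s)); split => //;
  [left|right].
Qed.

Lemma interval_mass_finite nu b : I b -> interval_mass nu ->
  finite_away_left l b nu.
Proof.
move=> Ib nuE a [la ab]; have Ia : I a by split => //; exact: lt_trans Ib.2.
by rewrite nuE ?ltry// ltW.
Qed.

Lemma radon_finite b : radon_on l r mu -> I b -> finite_away_left l b mu.
Proof.
move=> mu_radon Ib a [la ab]; apply: le_lt_trans (mu_radon a b la Ib.2).
apply: le_measure; rewrite ?inE//.
by move=> y /=; rewrite !in_itv/= => /andP[/ltW -> /ltW ->].
Qed.

Lemma left_end_solution_eq0 h : radon_on l r mu -> tame_left ->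
  kernel_solution l r mu (fun x y => s (Num.max x y) - s y)%R h ->
  forall x, I x -> h x = 0%R.
Proof.
move=> mu_radon [b [nu [Ib nuE finite]]] kh.
have [c Ic h0] : exists2 c, I c & forall y, ooitv l c%:E y -> h y = 0%R.
  case: finite => finite; last first.
    exact: (left_end_eq0_of_scale s_incr s_cont kh Ib).
  have [_ mnu tonelli] := tonelli_ooitv Ib.1 (radon_finite mu_radon Ib)
    (interval_mass_finite Ib nuE).
  apply: (left_end_eq0_of_mass s_incr s_cont kh Ib nuE mnu).
  by rewrite -tonelli.
have zfs : zero_flux_solution l r s mu h.
  apply: (zero_flux_of_kernel s_incr s_cont (q := id)) kh => //.
  by move=> x Ix; exists x => // y _ /ltW.
have [a [aI _ _]] := ooitv_left_seq Ic.1.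
have Ia := sub_ooitv Ic.2 (aI 0%N).
apply: (zfs_eq0_right s_incr s_cont zfs mu_radon Ia) => x Ix xa.
apply: h0; split; first exact: Ix.1.
by apply: le_lt_trans (aI 0%N).2; rewrite lee_fin.
Qed.

End tame_end.

(** * Reflection of the line *)

Section reflection.
Context {R : realType}.
Implicit Types (mu nu : {measure set R -> \bar R}).

Definition reflected (mu : {measure set R -> \bar R}) :
    {measure set R -> \bar R} :=
  image_measure mu (oppr_measurable (D := setT)).

Definition reflect_scale (s : R -> R) (x : R) : R := (- s (- x))%R.

Lemma opp_ooitv (l r : \bar R) (x : R) :
  ooitv (- r) (- l) x <-> ooitv l r (- x)%R.
Proof.
rewrite /ooitv/= EFinN lteNl [x%:E < _]lteNr.
by split=> -[].
Qed.

Lemma preimage_opp_ooitv (l r : \bar R) :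
  -%R @^-1` ooitv l r = ooitv (- r) (- l) :> set R.
Proof. by apply/seteqP; split => x /opp_ooitv. Qed.

Lemma opp_opp_preimage (D : set R) : -%R @^-1` (-%R @^-1` D) = D.
Proof. by apply/seteqP; split => x; rewrite /= opprK. Qed.

Lemma measurable_preimage_opp (D : set R) : measurable D ->
  measurable (-%R @^-1` D : set R).
Proof.
by move=> mD; rewrite -[X in measurable X]setTI; exact: oppr_measurable.
Qed.

Lemma reflectedE mu (D : set R) : reflected mu D = mu (-%R @^-1` D).
Proof. by []. Qed.

Lemma reflected_integral mu (D : set R) (f : R -> \bar R) : measurable D ->
  mu.-integrable D f ->
  (reflected mu).-integrable (-%R @^-1` D) (f \o -%R) /\
  \int[reflected mu]_(y in -%R @^-1` D) f (- y)%R = \int[mu]_(y in D) f y.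
Proof.
move=> mD fint; have mD' := measurable_preimage_opp mD.
pose G := (f \_ D) \o (-%R : R -> R).
have mG : measurable_fun [set: R] G.
  apply: measurableT_comp; last exact: oppr_measurable.
  by apply/(measurable_restrictT _ mD); exact: measurable_int fint.
have GE : {in -%R @^-1` D, G =1 f \o -%R}.
  by move=> y; rewrite inE => Dy; rewrite /G /= patchE mem_set.
have GoppE : {in D, f =1 G \o -%R}.
  by move=> y yD; rewrite /G /= opprK patchE yD.
have Gint : mu.-integrable (-%R @^-1` (-%R @^-1` D)) (G \o -%R).
  by rewrite opp_opp_preimage; apply: eq_integrable fint.
split.
  apply: (eq_integrable mD' _ _ GE).
  exact: (integrable_pushforward _ mG Gint mD').
rewrite -(eq_integral _ _ GE) integral_pushforward// opp_opp_preimage.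
by rewrite (eq_integral _ _ GoppE).
Qed.

Lemma reflected_ge0_integral mu (D : set R) (f : R -> \bar R) : measurable D ->
  measurable_fun D f -> (forall y, D y -> 0 <= f y) ->
  \int[reflected mu]_(y in D) f y = \int[mu]_(y in -%R @^-1` D) f (- y)%R.
Proof.
move=> mD mf f0; apply: ge0_integral_pushforward => //.
by move=> y; rewrite inE; exact: f0.
Qed.

Lemma reflected_kernel_solution (l r : \bar R) mu k h :
  kernel_solution l r mu k h ->
  kernel_solution (- r) (- l) (reflected mu)
    (fun x y => k (- x) (- y))%R (h \o -%R).
Proof.
move=> [hint heq]; have mI := measurable_ooitv l r.
split=> x /opp_ooitv Ix; have [fint fE] := reflected_integral mI (hint _ Ix).
  by move: fint; rewrite preimage_opp_ooitv.
by rewrite /= heq// /Rintegral -fE preimage_opp_ooitv.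
Qed.

Section reflected_data.
Context (l r : \bar R) (s : R -> R) (mu : {measure set R -> \bar R}).
Let I := ooitv l r.
Let I' := ooitv (- r) (- l).
Hypothesis s_incr : forall x y, I x -> I y -> (x < y)%R -> (s x < s y)%R.
Hypothesis s_cont : {within I, continuous s}.

Lemma reflect_scale_incr x y : I' x -> I' y -> (x < y)%R ->
  (reflect_scale s x < reflect_scale s y)%R.
Proof.
by move=> /opp_ooitv Ix /opp_ooitv Iy xy; rewrite ltrN2 s_incr// ltrN2.
Qed.

Lemma reflect_scale_cont : {within I', continuous (reflect_scale s)}.
Proof.
rewrite continuous_open_subspace; last exact: open_ooitv.
move=> x; rewrite inE => /opp_ooitv Ix.
have sx := scale_continuous_at s_cont Ix.
apply: continuousN; apply: continuous_comp; last exact: sx.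
exact: opp_continuous.
Qed.

Lemma reflected_radon : radon_on l r mu -> radon_on (- r) (- l) (reflected mu).
Proof.
move=> mu_radon a b ra bl; rewrite reflectedE opp_preimage_itvbndbnd.
by apply: mu_radon; rewrite EFinN; [rewrite lteNr|rewrite lteNl].
Qed.

Lemma reflected_interval_mass nu : interval_mass l r s nu ->
  interval_mass (- r) (- l) (reflect_scale s) (reflected nu).
Proof.
move=> nuE u v /opp_ooitv Iu /opp_ooitv Iv uv.
rewrite reflectedE opp_preimage_itvbndbnd /= nuE ?lerN2//.
by rewrite /reflect_scale opprK addrC.
Qed.

Lemma reflected_tame : radon_on l r mu -> tame_right l r s mu ->
  tame_left (- r) (- l) (reflect_scale s) (reflected mu).
Proof.
move=> mu_radon [b [nu [Ib nuE finite]]].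
have Ib' : I' (- b)%R by apply/opp_ooitv; rewrite opprK.
have nuE' := reflected_interval_mass nuE.
have mu_radon' := reflected_radon mu_radon.
exists (- b)%R, (reflected nu); split => //.
have mD := measurable_ooitv (- r) (- b)%:E.
have DE : -%R @^-1` ooitv (- r) (- b)%:E = ooitv b%:E r :> set R.
  by rewrite preimage_opp_ooitv oppeK EFinN oppeK.
case: finite => finite; [left|right].
- have [mmu _ _] := tonelli_ooitv Ib'.1 (radon_finite mu_radon' Ib')
    (interval_mass_finite Ib' nuE').
  rewrite reflected_ge0_integral// DE; apply: le_lt_trans finite.
  rewrite le_eqVlt; apply/orP; left; apply/eqP; apply: eq_integral => z _.
  by rewrite reflectedE opp_preimage_itvbndbnd /= !opprK.
- rewrite reflected_ge0_integral//.
  + rewrite DE; apply: le_lt_trans finite.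
    rewrite le_eqVlt; apply/orP; left; apply/eqP; apply: eq_integral => z _.
    by rewrite /reflect_scale !opprK addrC.
  + apply/measurable_EFinP; apply: measurable_funB => //.
    apply: measurable_funS (measurable_scale reflect_scale_cont).
      exact: measurable_ooitv.
    exact: sub_ooitv Ib'.2.
  + move=> y yb; rewrite lee_fin.
    exact: (scale_increment_ge0 reflect_scale_incr Ib' yb).
Qed.

End reflected_data.
End reflection.

(** * Differences of solutions *)

Section differences.
Context {R : realType} (l r : \bar R) (s : R -> R)
  (mu : {measure set R -> \bar R}).
Let I := ooitv l r.

Lemma kernel_solution_diff v c a kappa g1 g2 (k : R -> R -> R) :
  (forall x y, I x -> I y -> v x y = (k x y)%:E) ->
  nonneg_solution l r s mu v c a kappa g1 ->
  nonneg_solution l r s mu v c a kappa g2 ->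
  kernel_solution l r mu k (fun x => g1 x - g2 x)%R.
Proof.
move=> vE [_ i1 e1] [_ i2 e2]; have mI := measurable_ooitv l r.
have toE g x : I x -> {in ooitv l r,
    (fun y => v x y * (g y)%:E) =1 (EFin \o (fun y => k x y * g y)%R)}.
  by move=> Ix y; rewrite inE => Iy /=; rewrite vE// EFinM.
have ik g x : I x -> mu.-integrable (ooitv l r) (fun y => v x y * (g y)%:E) ->
    mu.-integrable (ooitv l r) (EFin \o (fun y => k x y * g y)%R).
  by move=> Ix; apply: (eq_integrable mI _ _ (toE g x Ix)).
split=> x Ix.
  have := integrableB mI (ik _ _ Ix (i1 _ Ix)) (ik _ _ Ix (i2 _ Ix)).
  by apply: eq_integrable => // y _ /=; rewrite -EFinB mulrBr.
under eq_Rintegral do rewrite mulrBr.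
rewrite RintegralB//; [|exact: ik (i1 _ Ix)|exact: ik (i2 _ Ix)].
rewrite /Rintegral -!(eq_integral _ _ (toE _ _ Ix)).
have f1 := integrable_fin_num mI (i1 _ Ix).
have f2 := integrable_fin_num mI (i2 _ Ix).
move: (e1 _ Ix) (e2 _ Ix) f1 f2.
case: (\int[mu]_(y in ooitv l r) (v x y * (g1 y)%:E)) => [u1| |]//.
case: (\int[mu]_(y in ooitv l r) (v x y * (g2 y)%:E)) => [u2| |]//.
case: (a%:E + _) => [w| |]//.
by rewrite -!EFinD => -[->] [->] _ _ /=; ring.
Qed.

Lemma scale_extE x : I x -> scale_ext l r s x%:E = (s x)%:E.
Proof. by move=> [lx xr]; rewrite /scale_ext /ext_lim lx xr. Qed.

Lemma v_left_interior c x y : I c -> I x -> I y ->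
  v_left l r s c%:E x y = (s (Num.max x y) - s (Num.max c y))%:E.
Proof.
move=> Ic Ix Iy; rewrite /v_left -!EFin_max !scale_extE//; exact: ooitv_max.
Qed.

Lemma v_left_end x y : I x -> I y ->
  v_left l r s l x y = (s (Num.max x y) - s y)%:E.
Proof.
move=> Ix Iy; rewrite /v_left -EFin_max (max_r (ltW Iy.1)) !scale_extE//.
exact: ooitv_max.
Qed.

Lemma ooitv_min x y : I x -> I y -> I (Num.min x y).
Proof. by rewrite /Num.min; case: ifP. Qed.

Lemma v_right_interior c x y : I c -> I x -> I y ->
  v_right l r s c%:E x y = (s (Num.min c y) - s (Num.min x y))%:E.
Proof.
move=> Ic Ix Iy; rewrite /v_right -!EFin_min !scale_extE//; exact: ooitv_min.
Qed.

Lemma v_right_end x y : I x -> I y ->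
  v_right l r s r x y = (s y - s (Num.min x y))%:E.
Proof.
move=> Ix Iy; rewrite /v_right -EFin_min (min_r (ltW Iy.2)) !scale_extE//.
exact: ooitv_min.
Qed.

End differences.

Section uniqueness.
Context {R : realType} (l r : \bar R) (s : R -> R)
  (mu : {measure set R -> \bar R}).
Let I := ooitv l r.
Hypothesis s_incr : forall x y, I x -> I y -> (x < y)%R -> (s x < s y)%R.
Hypothesis s_cont : {within I, continuous s}.
Hypothesis mu_radon : radon_on l r mu.

Lemma uniqueness_left_interior c a kappa : I c ->
  at_most_one l r (nonneg_solution l r s mu (v_left l r s c%:E) c%:E a kappa).
Proof.
move=> Ic g1 g2 sol1 sol2 x Ix; apply/eqP; rewrite -subr_eq0; apply/eqP.
have kh := kernel_solution_diff (fun x y => v_left_interior s Ic) sol1 sol2.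
exact: (kernel_solution_eq0 s_incr s_cont mu_radon Ic kh Ix).
Qed.

Lemma uniqueness_left_end a kappa : ~ natural_left l r s mu ->
  at_most_one l r (nonneg_solution l r s mu (v_left l r s l) l a kappa).
Proof.
move=> nnat g1 g2 sol1 sol2 x Ix; apply/eqP; rewrite -subr_eq0; apply/eqP.
have kh := kernel_solution_diff (v_left_end s) sol1 sol2.
have tame := tame_left_of_not_natural s_incr s_cont nnat.
exact: (left_end_solution_eq0 s_incr s_cont mu_radon tame kh Ix).
Qed.

Lemma uniqueness_right_interior c a kappa : I c ->
  at_most_one l r (nonneg_solution l r s mu (v_right l r s c%:E) c%:E a kappa).
Proof.
move=> Ic g1 g2 sol1 sol2 x Ix; apply/eqP; rewrite -subr_eq0; apply/eqP.
have kh := kernel_solution_diff (fun x y => v_right_interior s Ic) sol1 sol2.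
have Ic' : ooitv (- r) (- l) (- c)%R by apply/opp_ooitv; rewrite opprK.
have Ix' : ooitv (- r) (- l) (- x)%R by apply/opp_ooitv; rewrite opprK.
have := reflected_kernel_solution kh.
rewrite (_ : (fun x y => _) = fun x y =>
  reflect_scale s (Num.max x y) - reflect_scale s (Num.max (- c) y))%R.
  move=> /(kernel_solution_eq0 (reflect_scale_incr s_incr)
    (reflect_scale_cont s_cont) (reflected_radon mu_radon) Ic')/(_ _ Ix') /=.
  by rewrite opprK.
apply/funext => y; apply/funext => z.
by rewrite /reflect_scale !oppr_max !opprK addrC.
Qed.

Lemma uniqueness_right_end a kappa : ~ natural_right l r s mu ->
  at_most_one l r (nonneg_solution l r s mu (v_right l r s r) r a kappa).
Proof.
move=> nnat g1 g2 sol1 sol2 x Ix; apply/eqP; rewrite -subr_eq0; apply/eqP.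
have kh := kernel_solution_diff (v_right_end s) sol1 sol2.
have tame := tame_right_of_not_natural s_incr s_cont nnat.
have Ix' : ooitv (- r) (- l) (- x)%R by apply/opp_ooitv; rewrite opprK.
have := reflected_kernel_solution kh.
rewrite (_ : (fun x y => _) = fun x y =>
  reflect_scale s (Num.max x y) - reflect_scale s y)%R.
  move=> /(left_end_solution_eq0 (reflect_scale_incr s_incr)
    (reflect_scale_cont s_cont) (reflected_radon mu_radon)
    (reflected_tame s_incr s_cont mu_radon tame))/(_ _ Ix') /=.
  by rewrite opprK.
apply/funext => y; apply/funext => z.
by rewrite /reflect_scale !oppr_max !opprK addrC.
Qed.

End uniqueness.

Theorem theorem4p2 (R : realType) (l r : \bar R) (hlr : l < r)
  (d : measure_display) (Om : measurableType d)
  (F : R -> set (set Om)) (X : R -> Om -> \bar R) (theta : R -> Om -> Om)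
  (P : \bar R -> probability Om R)
  (hX : regular_diffusion l r F X theta P)
  (s : R -> R) (hs : scale_function l r X P s)
  (m : {measure set R -> \bar R}) (hm : speed_measure l r X P s m)
  (A : R -> Om -> \bar R) (hA : pcaf l r F X theta P A)
  (mu : {measure set R -> \bar R}) (hmu : revuz_measure l r X P m A mu)
  (mu_gt0 : 0 < mu (ooitv l r)) :
  (forall (c : \bar R) (a kappa : R), l < c < r -> (0 <= a)%R ->
     at_most_one l r (fun g =>
       nonneg_solution l r s mu (v_left l r s c) c a kappa g /\
       ui_near_left l r F X P g) /\
     at_most_one l r (fun g =>
       nonneg_solution l r s mu (v_right l r s c) c a kappa g /\
       ui_near_right l r F X P g)) /\
  ((~ natural_left l r s mu ->
    forall a kappa : R, (0 <= a)%R -> (0 <= kappa)%R ->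
    at_most_one l r (fun g =>
      nonneg_solution l r s mu (v_left l r s l) l a kappa g /\
      ui_near_left l r F X P g)) /\
   (~ natural_right l r s mu ->
    forall a kappa : R, (0 <= a)%R -> (kappa <= 0)%R ->
    at_most_one l r (fun g =>
      nonneg_solution l r s mu (v_right l r s r) r a kappa g /\
      ui_near_right l r F X P g))).
Proof.
have s_incr := scale_increasing hs; have s_cont := Defs.scale_continuous hs.
have mu_radon := revuz_radon hmu.
split.
  move=> [c| |] a kappa /andP[lc cr] _; last 2 first.
  - by move: cr; rewrite ltNge leey.
  - by move: lc; rewrite ltNge leNye.
  split=> g1 g2 [sol1 _] [sol2 _].
  - exact: (uniqueness_left_interior _ _ mu_radon (conj lc cr)) sol1 sol2.
  - exact: (uniqueness_right_interior _ _ mu_radon (conj lc cr)) sol1 sol2.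
split=> nnat a kappa _ _ g1 g2 [sol1 _] [sol2 _].
- exact: (uniqueness_left_end s_incr s_cont mu_radon nnat) sol1 sol2.
- exact: (uniqueness_right_end s_incr s_cont mu_radon nnat) sol1 sol2.
Qed.
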